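(* Let $Q^{(k)}$, $k=0,1,2,\ldots$, be the random probability measures on $(\Omega,\mu)$ produced by the random recursive partitioning process with optional stopping described in the context, with stopping rule $\rho$, selection probability vectors $\boldsymbol\lambda(A)$ and assignment weight vectors $\boldsymbol\alpha^j(A)$. Suppose there is a $\delta>0$ such that, with probability $1$, $1-\delta>\rho(A)>\delta$ for any region $A$ generated during any step of the recursive partitioning process. Then, with probability $1$, $Q^{(k)}$ converges in variational distance (that is, $\sup_{B}|Q^{(k)}(B)-Q(B)|\to 0$, the supremum being over measurable $B\subset\Omega$) to a probability measure $Q$ that is absolutely continuous with respect to $\mu$.
   Context: **Space.** $\Omega$ is either a finite set, with $\mu$ the counting measure, or a bounded rectangle in $\mathbb{R}^p$, with $\mu$ the Lebesgue measure. **Partitioning scheme.** $\Omega$ itself is regarded as the elementary region of level $0$. Every elementary region $A$ of level $k\ge 0$ is equipped with a finite number $M(A)\ge 1$ of ways to partition it: for $j=1,\ldots,M(A)$, $A=\bigcup_{l=1}^{K^j(A)}A_l^j$, a finite disjoint union. The sets $A_l^j$ so obtained are elementary regions of level $k+1$. All elementary regions are measurable with positive $\mu$-measure. $\mathcal{A}^k$ denotes the set of all possible level-$k$ elementary regions, $\mathcal{A}^{(k)}=\bigcup_{l=1}^k\mathcal{A}^l$. If $\Omega$ is finite, it is assumed that $\mathcal{A}^k$ separates points of $\Omega$ for $k$ large enough. If $\Omega$ is a rectangle, it is assumed that for every open $B\subset\Omega$ there exist $B_n\uparrow B$ where each $B_n$ is a finite union of disjoint regions in $\mathcal{A}^{(n)}$.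 **Parameters.** For each elementary region $A$: a nonrandom selection probability vector $\boldsymbol\lambda(A)=(\lambda_1,\ldots,\lambda_{M(A)})$ with $\lambda_j\ge 0$, $\sum_j\lambda_j=1$; and, for each $j\le M(A)$, a nonrandom assignment weight vector $\boldsymbol\alpha^j(A)=(\alpha_1^j,\ldots,\alpha^j_{K^j(A)})$ with positive entries. There is also a stopping rule $\rho$, which gives a stopping probability $\rho(A)\in[0,1]$ as specified below. **Random recursive partitioning with optional stopping.** Start with $T_0^0=\emptyset$, $T_1^0=\Omega$ and $Q^{(0)}$ the uniform distribution on $\Omega$. After $k$ steps one has $\Omega=T_0^k\cup T_1^k$ (disjoint), where $T_0^k$ (the stopped part) is a disjoint union of stopped elementary regions of level at most $k-1$, and $T_1^k$ (the continuing part) is a disjoint union of regions in $\mathcal{A}^k$ (for $k=0$, the single region $\Omega$); and a random probability measure $Q^{(k)}$ which is uniformly distributed (with respect to $\mu$) within each region of these decompositions. Let $\mathcal{F}^{(k)}$ be the $\sigma$-field generated by all random variables used in the first $k$ steps. In step $k+1$, for each region $A$ in the decomposition of $T_1^k$, with independent draws (given $\mathcal F^{(k)}$) for the different regions and variables: - Draw $S\sim\mathrm{Bernoulli}(\rho(A))$, where $\rho(A)$ is required to be $\mathcal{F}^{(k)}$-measurable. If $S=1$, stop further partitioning of $A$ and add it to the set of stopped regions. - If $S=0$, draw $J\in\{1,\ldots,M(A)\}$ with $P(J=j)=\lambda_j(A)$. If $J=j$, partition $A=\bigcup_{l}A_l^j$ in the $j$th way and set $Q^{(k+1)}(A_l^j)=Q^{(k)}(A)\,\theta_l^j$,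 where $\boldsymbol\theta^j=(\theta^j_1,\ldots,\theta^j_{K^j(A)})$ is drawn from the Dirichlet distribution with parameter $\boldsymbol\alpha^j(A)$. This yields $T_0^{k+1}\supset T_0^k$ and $T_1^{k+1}\subset T_1^k$. For $B\subset T_0^{k+1}$ set $Q^{(k+1)}(B)=Q^{(k)}(B)$. If $T_1^{k+1}=\bigcup_i A_i$ with $A_i\in\mathcal{A}^{k+1}$ disjoint, then for $B\subset T_1^{k+1}$ set $Q^{(k+1)}(B)=\sum_i Q^{(k+1)}(A_i)\,\mu(A_i\cap B)/\mu(A_i)$. *)

(* Defs.v *)
From HB Require Import structures.
From mathcomp Require Import all_boot all_order all_algebra.
From mathcomp Require Import all_classical all_reals all_analysis.

Set Implicit Arguments.
Unset Strict Implicit.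
Unset Printing Implicit Defensive.

Import Order.TTheory GRing.Theory Num.Theory numFieldNormedType.Exports.

Local Open Scope classical_set_scope.
Local Open Scope ring_scope.

(* Lebesgue measure on R^n, with R^n represented by n.-tuple R and its product
   (Borel) sigma-algebra: \d_[tuple] for n = 0, and the image of
   lebesgue_measure \x nu under (x, t) |-> x :: t in the inductive step. *)
Section lebesgue_cons.
Context {R : realType} (n : nat).
Variable nu : {sigma_finite_measure set (n.-tuple R) -> \bar R}.

Let cons_pair (x : measurableTypeR R * n.-tuple R) : n.+1.-tuple R :=
  [tuple of (x.1 : R) :: x.2].

Let measurable_cons_pair : measurable_fun setT cons_pair.
Proof. exact: (@measurable_cons _ _ _ R fst n snd). Qed.

Let measurable_cons_pairV A :
  measurable A -> measurable (cons_pair @^-1` A).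
Proof.
by move=> mA; rewrite -[X in measurable X]setTI; exact: measurable_cons_pair.
Qed.

Definition lebesgue_cons : set (n.+1.-tuple R) -> \bar R :=
  pushforward (lebesgue_measure \x nu)%E cons_pair.

Let lebesgue_cons0 : lebesgue_cons set0 = 0%E.
Proof. by rewrite /lebesgue_cons /pushforward preimage_set0 measure0. Qed.

Let lebesgue_cons_ge0 A : (0 <= lebesgue_cons A)%E.
Proof. exact: measure_ge0. Qed.

Let lebesgue_cons_sigma_additive : semi_sigma_additive lebesgue_cons.
Proof.
move=> F mF tF mUF; rewrite /lebesgue_cons /pushforward preimage_bigcup.
apply: measure_semi_sigma_additive.
- by move=> i; exact: measurable_cons_pairV.
- apply/trivIsetP => /= i j _ _ ij; rewrite -preimage_setI.
  by move/trivIsetP : tF => /(_ _ _ _ _ ij) ->//; rewrite preimage_set0.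
- by rewrite -preimage_bigcup; exact: measurable_cons_pairV.
Qed.

HB.instance Definition _ := isMeasure.Build _ _ _ lebesgue_cons
  lebesgue_cons0 lebesgue_cons_ge0 lebesgue_cons_sigma_additive.

Lemma lebesgue_consE (A : set (measurableTypeR R)) (B : set (n.-tuple R)) :
  measurable A -> measurable B ->
  lebesgue_cons [set t | A (thead t) /\ B [tuple of behead t]] =
  (lebesgue_measure A * nu B)%E.
Proof.
move=> mA mB; rewrite -product_measure1E//; congr (product_measure1 _ _ _).
apply/funext => -[x t] /=; rewrite /cons_pair /= theadE.
congr (A x /\ B _); exact: val_inj.
Qed.

Let lebesgue_cons_sigma_finite : sigma_finite setT lebesgue_cons.
Proof.
have /sigma_finiteP[F [TF ndF Foo]] :=
  sigma_finiteT (@lebesgue_measure R).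
have /sigma_finiteP[G [TG ndG Goo]] := sigma_finiteT nu.
exists (fun n => [set t | F n (thead t) /\ G n [tuple of behead t]]).
  apply/seteqP; split => // t _.
  have [i _ Fi] : (\bigcup_i F i) (thead t) by rewrite -TF.
  have [j _ Gj] : (\bigcup_i G i) [tuple of behead t] by rewrite -TG.
  exists (maxn i j) => //; split.
  - by move: (thead t) Fi; exact/subsetPset/ndF/leq_maxl.
  - by move: [tuple of behead t] Gj; exact/subsetPset/ndG/leq_maxr.
move=> k; have [mF Fy] := Foo k; have [mG Gy] := Goo k; split; last first.
  by rewrite lebesgue_consE// lte_mul_pinfty// ge0_fin_numE.
apply: measurableI; rewrite -[X in measurable X]setTI.
- exact: (@measurable_tnth _ R n.+1 ord0 measurableT (F k)).
- exact: (@measurable_behead _ R n measurableT (G k)).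
Qed.

HB.instance Definition _ := Measure_isSigmaFinite.Build _ _ _ lebesgue_cons
  lebesgue_cons_sigma_finite.

End lebesgue_cons.

Fixpoint lebesgue_tuple {R : realType} (n : nat) :
    {sigma_finite_measure set (n.-tuple R) -> \bar R} :=
  match n with
  | 0 => \d_([tuple] : 0.-tuple R)
  | m.+1 => lebesgue_cons (lebesgue_tuple m)
  end.

Lemma lebesgue_tuple_box (R : realType) (n : nat) (A : 'I_n -> set R) :
  (forall i, measurable (A i)) ->
  lebesgue_tuple n [set t | forall i, A i (tnth t i)] =
  (\prod_(i < n) lebesgue_measure (A i : set (measurableTypeR R)))%E.
Proof.
elim: n A => [|n IH] A mA.
  by rewrite big_ord0 /= diracE mem_set//; case.
have mB : measurable [set t : n.-tuple R | forall i, A (lift ord0 i) (tnth t i)].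
  rewrite [X in measurable X](_ : _ = \bigcap_(i in [set: 'I_n])
      ((fun t : n.-tuple R => tnth t i) @^-1` A (lift ord0 i))).
    apply: fin_bigcap_measurable => // i _; rewrite -[X in measurable X]setTI.
    exact: (@measurable_tnth _ R n i measurableT).
  by apply/seteqP; split => t /= h i; [move=> _|]; exact: h.
rewrite big_ord_recl -(IH (fun i => A (lift ord0 i)))//.
rewrite -(lebesgue_consE _ (mA ord0) mB) /=.
congr (lebesgue_cons _ _); apply/seteqP; split => t /=.
  move=> h; split; first exact: (h ord0).
  by move=> i; have := h (lift ord0 i); rewrite [in X in X -> _](tuple_eta t) tnthS.
move=> [h0 h] i; case: (unliftP ord0 i) => [j ->|->//].
by have := h j; rewrite [in X in _ -> X](tuple_eta t) tnthS.
Qed.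

Section partitions.
Context {R : realType} {d : measure_display} {T : measurableType d}.

(* Ways and pieces are numbered from 0: for j < nways A, the j-th way to
   partition A has the pieces piece A j l, l < npieces A j. The fields are only
   meaningful at elementary regions and at indices within these bounds. *)
Record partition_scheme := PartitionScheme {
  nways : set T -> nat;
  npieces : set T -> nat -> nat;
  piece : set T -> nat -> nat -> set T }.

Variables (mu : {measure set T -> \bar R}) (Om : set T).
Variable sch : partition_scheme.

Fixpoint region (k : nat) : set (set T) :=
  match k with
  | 0 => [set Om]
  | k'.+1 => [set B | exists A j l, [/\ region k' A, (j < nways sch A)%N,
                        (l < npieces sch A j)%N & B = piece sch A j l]]
  end.

Record valid_scheme : Prop := ValidScheme {
  region_measurable : forall k A, region k A -> measurable A;
  region_gt0 : forall k A, region k A -> (0 < mu A)%E;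
  nways_gt0 : forall k A, region k A -> (0 < nways sch A)%N;
  region_pieces : forall k A j, region k A -> (j < nways sch A)%N ->
    A = \bigcup_(l in `I_(npieces sch A j)) piece sch A j l /\
    trivIset `I_(npieces sch A j) (piece sch A j) }.

Definition selection_probabilities (lambda : set T -> nat -> R) : Prop :=
  forall k A, region k A ->
    (forall j, (j < nways sch A)%N -> 0 <= lambda A j) /\
    \sum_(j < nways sch A) lambda A j = 1.

Definition assignment_weights (alpha : set T -> nat -> nat -> R) : Prop :=
  forall k A j l, region k A -> (j < nways sch A)%N ->
    (l < npieces sch A j)%N -> 0 < alpha A j l.

End partitions.
Arguments partition_scheme {d} T.

Definition separates_points (T : Type) (Om : set T) (C : set (set T)) : Prop :=
  forall x y, Om x -> Om y -> x <> y -> exists A, [/\ C A, A x & ~ A y].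

Definition finite_disjoint_union (T : Type) (C : set (set T)) (B : set T) :
    Prop :=
  exists F : set (set T),
    [/\ finite_set F, F `<=` C, trivIset F id & B = \bigcup_(A in F) A].

(* The product topology of R^p is taken from the library's row vectors. *)
Definition open_tuple (R : realType) (p : nat) (B : set (p.-tuple R)) : Prop :=
  open [set v : 'rV[R]_p | B [tuple v ord0 i | i < p]].

(* The Boolean flags decide which of the end points belong to the sides. *)
Definition rectangle (R : realType) (p : nat) (a b : 'I_p -> R)
    (sa sb : 'I_p -> bool) : set (p.-tuple R) :=
  [set t | forall i,
     tnth t i \in Interval (BSide (sa i) (a i)) (BSide (sb i) (b i))].

(* The admissible (Omega, mu), together with the condition that links them to
   the sets reg k of level-k elementary regions. *)
Inductive base_space (R : realType) : forall d (T : measurableType d),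
    {measure set T -> \bar R} -> set T -> (nat -> set (set T)) -> Prop :=
| FiniteSpace d (T : measurableType d) (reg : nat -> set (set T)) :
    finite_set [set: T] -> (forall A : set T, measurable A) ->
    (\forall k \near \oo, separates_points [set: T] (reg k)) ->
    base_space (@counting T R) [set: T] reg
| RectangleSpace p (a b : 'I_p -> R) (sa sb : 'I_p -> bool)
    (reg : nat -> set (set (p.-tuple R))) :
    (0 < p)%N -> (forall i, a i < b i) ->
    (forall B, open_tuple B -> B `<=` rectangle a b sa sb ->
       exists Bn : nat -> set (p.-tuple R),
         [/\ forall n, finite_disjoint_union
                         (\bigcup_(l in [set l | 1 <= l <= n]%N) reg l) (Bn n),
             nondecreasing_seq Bn & \bigcup_n Bn n = B]) ->
    base_space (lebesgue_tuple p) (rectangle a b sa sb) reg.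

Section dirichlet.
Context {R : realType} (K : nat) (a : nat -> R).

(* (t_0, ..., t_{K-2}) |-> (t_0, ..., t_{K-2}, 1 - t_0 - ... - t_{K-2}) *)
Definition simplex_point (t : K.-1.-tuple R) : K.-tuple R :=
  [tuple nth (1 - \sum_(x <- t) x) t i | i < K].

Definition dirichlet_mass (U : set (K.-tuple R)) : \bar R :=
  (\int[lebesgue_tuple K.-1]_(t in [set t |
       (forall i, 0 < tnth (simplex_point t) i)%R /\ U (simplex_point t)])
     (\prod_(i < K) tnth (simplex_point t) i `^ (a i - 1))%:E)%E.

(* Probability of U under the Dirichlet distribution with parameter
   (a 0, ..., a (K - 1)), K > 0, all a i > 0: its density in the first K - 1
   coordinates is proportional to \prod_i x_i ^ (a i - 1) on the open simplex.
   For K = 1 it is the point mass at [tuple 1]. *)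
Definition dirichlet (U : set (K.-tuple R)) : R :=
  fine (dirichlet_mass U) / fine (dirichlet_mass setT).

End dirichlet.

Section random_partitioning.
Context {R : realType} {d : measure_display} {T : measurableType d}.
Variables (mu : {measure set T -> \bar R}) (Om : set T).
Variable sch : partition_scheme T.
Context {dW : measure_display} {W : measurableType dW}.

(* The variables S, J and theta^j attached to the region A in step k + 1. They
   are used only if they are actually drawn (A a continuing region after k
   steps, S = 0, J = j); nothing is assumed about their values otherwise. *)
Record draws := Draws {
  stop : nat -> set T -> {mfun W >-> bool};
  way : nat -> set T -> {mfun W >-> nat};
  share : forall (k : nat) (A : set T) (j : nat),
    {mfun W >-> (npieces sch A j).-tuple R} }.

Variable X : draws.

(* The regions in the decomposition of T_1^k; stopped_part k is T_0^k. *)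
Fixpoint continuing (k : nat) (w : W) : seq (set T) :=
  match k with
  | 0 => [:: Om]
  | k'.+1 =>
      flatten [seq [seq piece sch A (way X k' A w) l
                     | l <- iota 0 (npieces sch A (way X k' A w))]
                | A <- continuing k' w & ~~ stop X k' A w]
  end.

Fixpoint stopped_part (k : nat) (w : W) : set T :=
  match k with
  | 0 => set0
  | k'.+1 => stopped_part k' w `|`
             \big[setU/set0]_(A <- continuing k' w | stop X k' A w) A
  end.

Definition uniform_on (A B : set T) : R := fine (mu (A `&` B)) / fine (mu A).

(* Q^(k); in the successor case the sum runs over the regions of T_1^(k+1),
   each listed as a piece of the region it was cut from. *)
Fixpoint random_measure (k : nat) (w : W) (B : set T) : R :=
  match k with
  | 0 => uniform_on Om B
  | k'.+1 =>
      random_measure k' w (stopped_part k'.+1 w `&` B) +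
      \sum_(A <- continuing k' w | ~~ stop X k' A w)
        \sum_(l < npieces sch A (way X k' A w))
          random_measure k' w A * tnth (share X k' A (way X k' A w) w) l *
          uniform_on (piece sch A (way X k' A w) l) B
  end.

(* F^(k), generated by the variables drawn in the first k steps *)
Definition drawn_events (k : nat) : set (set W) :=
  [set E | exists i A, [/\ (i < k)%N, region Om sch i A &
     E = [set w | A \in continuing i w /\ stop X i A w] \/
     exists j (V : set ((npieces sch A j).-tuple R)), measurable V /\
       E = [set w | [/\ A \in continuing i w, ~~ stop X i A w,
                        way X i A w = j & V (share X i A j w)]]]].

Definition filtration (k : nat) : set (set W) := <<s drawn_events k >>.

Variable P : probability W R.
Variables (lambda : set T -> nat -> R) (alpha : set T -> nat -> nat -> R).

(* rho k A w is the value of rho(A) used in step k + 1; it matters only where A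
   is a continuing region after k steps. *)
Variable rho : nat -> set T -> W -> R.

(* For D a possible decomposition of T_1^k, a joint outcome of the draws of step
   k + 1 is given by s, j and U: the region A in D is stopped if s A, and
   otherwise it is partitioned in the way j A with a vector theta in U A.
   draws_law states that, on {T_1^k is decomposed as D}, the conditional
   probability of this outcome given F^(k) is the product over A in D of
   rho(A) or (1 - rho(A)) * lambda_j(A) * Dirichlet(alpha^j(A))(U A). *)
Record recursive_partitioning : Prop := RecursivePartitioning {
  way_lt : forall k A w, A \in continuing k w -> ~~ stop X k A w ->
    (way X k A w < nways sch A)%N;
  rho_itv : forall k A w, A \in continuing k w -> 0 <= rho k A w <= 1;
  rho_measurable : forall k A (V : set R), region Om sch k A -> measurable V ->
    filtration k [set w | A \in continuing k w /\ V (rho k A w)];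
  draws_law : forall k (D : seq (set T)) (G : set W),
    filtration k G -> (forall w, G w -> continuing k w = D) ->
    forall (s : set T -> bool) (j : set T -> nat)
      (U : forall A, set ((npieces sch A (j A)).-tuple R)),
    (forall A, A \in D -> (j A < nways sch A)%N /\ measurable (U A)) ->
    (P (G `&` [set w | forall A, A \in D -> stop X k A w = s A /\
          (~~ s A -> way X k A w = j A /\ U A (share X k A (j A) w))]) =
     \int[P]_(w in G) (\prod_(A <- D)
       if s A then rho k A w
       else (1 - rho k A w) * lambda A (j A) *
            dirichlet (alpha A (j A)) (U A))%:E)%E }.

End random_partitioning.
Arguments draws R {d T} sch {dW} W.

Definition variational_distance (R : realType) d (T : measurableType d)
    (Om : set T) (Q1 : set T -> R) (Q2 : set T -> \bar R) : \bar R :=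
  ereal_sup [set `|(Q1 B)%:E - Q2 B|%E | B in
    [set B | measurable B /\ B `<=` Om]].

(* Main.v *)
Require Import Defs.
From HB Require Import structures.
From mathcomp Require Import all_boot all_order all_algebra.
From mathcomp Require Import all_classical all_reals all_analysis.
From mathcomp Require Import measurable_realfun lra.

Set Implicit Arguments.
Unset Strict Implicit.
Unset Printing Implicit Defensive.

Import Order.TTheory GRing.Theory Num.Theory numFieldNormedType.Exports.

Local Open Scope classical_set_scope.
Local Open Scope ring_scope.

(* Let q_k be the mass that Q^(k) gives to the continuing part T_1^k. Given
   F^(k), each continuing region A goes on with probability 1 - rho(A), which is
   less than 1 - delta, and the Dirichlet weights redistribute the mass of A
   among its pieces without changing it; hence E q_{k+1} <= (1 - delta) E q_k.
   As q_k is nonincreasing, q_k --> 0 almost surely. On the stopped part Q^(k) is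
   never changed again, so the limit is
     Q = \sum_k \sum_(A stopped in step k + 1) Q^(k)(A) mu(. `&` A) / mu(A),
   whose total mass is lim (1 - q_k) = 1 and which is at variational distance at
   most q_k from Q^(k). *)

(** The deterministic and the random part are kept apart. At a fixed outcome whose drawn shares lie
    in the simplex, every statement about Q is one about finite sums and a series of nonnegative
    terms, with q_k --> 0 as the only input from probability. On the exceptional null set the values
    of Q^(k) may be negative, hence the absolute values in the masses that are integrated. The law
    of the draws is given by joint probabilities on events G of F^(k) on which the decomposition is
    a fixed list. Regions range over the uncountable type [set T], so these events are organised by
    natural-number codes of the past choices, and W is cut into countably many fibres. Conditional
    expectations are replaced by measures: P(G and S = 0) <= (1 - delta) P(G) is read as a
    comparison of two measures on F^(k), which carries over to integrals of F^(k)-measurable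
    functions such as |Q^(k)(A)|. The Dirichlet laws enter through their support: almost surely the
    shares sum to 1, which reduces q_{k+1} to the Q^(k)-mass of the regions not stopped before
    anything is integrated. *)

Lemma zip_map_r (S1 S2 : Type) (g : S1 -> S2) s :
  zip s [seq g x | x <- s] = [seq (x, g x) | x <- s].
Proof. by elim: s => //= x s ->. Qed.

(** A boolean relation, so that [pairwise] applies. Since [pairwise] compares positions in the list,
    it also shows that no nonempty region is listed twice. *)
Definition disjointb (T : Type) (A B : set T) : bool := `[< A `&` B = set0 >].

Lemma pairwise_disjointb_flatten (T : Type) (f : set T -> seq (set T)) s :
  pairwise (@disjointb T) s ->
  (forall A, A \in s ->
     pairwise (@disjointb T) (f A) /\ forall B, B \in f A -> B `<=` A) ->
  pairwise (@disjointb T) (flatten [seq f A | A <- s]).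
Proof.
elim: s => //= A s IH /andP[As ps] fs.
rewrite pairwise_cat IH// ?andbT; last first.
  by move=> B Bs; apply: fs; rewrite inE Bs orbT.
have [fA fAs] := fs A (mem_head _ _).
rewrite fA andbT; apply/allrelP => B C BfA /flattenP[_ /mapP[D Ds ->]] CfD.
have /allP/(_ _ Ds)/asboolP AD := As.
have [_ fDs] : _ := fs D (mem_behead (s := A :: s) Ds).
apply/asboolP/seteqP; split => // x [Bx Cx]; rewrite -AD; split.
  exact: fAs BfA _ Bx.
exact: fDs CfD _ Cx.
Qed.

(** * Decompositions and random measures at a fixed outcome *)

Section path.
Context {R : realType} {d : measure_display} {T : measurableType d}.
Variables (mu : {measure set T -> \bar R}) (Om : set T).
Variable sch : partition_scheme T.
Context {dW : measure_display} {W : measurableType dW}.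
Variable X : draws R sch W.
Hypothesis sch_valid : valid_scheme mu Om sch.
Hypothesis mu_Om : (mu Om < +oo)%E.
Hypothesis way_lt_nways : forall k A w,
  A \in continuing Om X k w -> ~~ stop X k A w ->
  (way X k A w < nways sch A)%N.

Local Notation cont := (continuing Om X).
Local Notation rm := (random_measure mu Om X).
Local Notation stopped := (stopped_part Om X).

Lemma region_subset k A : region Om sch k A -> A `<=` Om.
Proof.
elim: k A => [A ->//|k IH B [A [j [l [rA jA lA ->]]]]].
apply: subset_trans (IH _ rA) => x Bx.
by have [-> _] := region_pieces sch_valid rA jA; exists l.
Qed.

Lemma region_fin_num k A : region Om sch k A -> mu A \is a fin_num.
Proof.
move=> rA; rewrite ge0_fin_numE//; apply: le_lt_trans mu_Om.
apply: le_measure; rewrite ?inE; last exact: region_subset rA.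
  exact: (region_measurable sch_valid) rA.
exact: (region_measurable sch_valid (k := 0)).
Qed.

Lemma region_fine_gt0 k A : region Om sch k A -> 0 < fine (mu A).
Proof.
by move=> rA; rewrite fine_gt0// (region_gt0 sch_valid rA)/= ltey_eq
  (region_fin_num rA).
Qed.

Lemma region_neq0 k A : region Om sch k A -> A <> set0.
Proof.
by move=> rA A0; have := region_gt0 sch_valid rA; rewrite A0 measure0 ltxx.
Qed.

Lemma continuingSP k w B :
  reflect (exists2 A, A \in cont k w /\ ~~ stop X k A w &
     exists2 l, (l < npieces sch A (way X k A w))%N &
       B = piece sch A (way X k A w) l)
  (B \in cont k.+1 w).
Proof.
apply: (iffP flattenP) => [[s /mapP[A]]|[A [Ac As] [l lA ->]]].
  rewrite mem_filter => /andP[As Ac] -> /mapP[l].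
  by rewrite mem_iota => /andP[_ lA] ->; exists A => //; exists l.
exists [seq piece sch A (way X k A w) l
         | l <- iota 0 (npieces sch A (way X k A w))].
  by apply/mapP; exists A => //; rewrite mem_filter As.
by apply/mapP; exists l => //; rewrite mem_iota.
Qed.

Lemma continuing_region k w A : A \in cont k w -> region Om sch k A.
Proof.
elim: k A => [A|k IH B]; first by rewrite inE => /eqP.
move=> /continuingSP[A [Ac As] [l lA ->]].
by exists A, (way X k A w), l; split => //; [exact: IH|exact: way_lt_nways].
Qed.

Lemma piece_subset k A j l : region Om sch k A -> (j < nways sch A)%N ->
  (l < npieces sch A j)%N -> piece sch A j l `<=` A.
Proof.
move=> rA jA lA x Ax; have [AE _] := region_pieces sch_valid rA jA.
by rewrite AE; exists l.
Qed.

Lemma piece_region k A j l : region Om sch k A -> (j < nways sch A)%N ->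
  (l < npieces sch A j)%N -> region Om sch k.+1 (piece sch A j l).
Proof. by move=> rA jA lA; exists A, j, l. Qed.

Lemma piece_disjoint k A j l l' : region Om sch k A -> (j < nways sch A)%N ->
  (l < npieces sch A j)%N -> (l' < npieces sch A j)%N -> l != l' ->
  piece sch A j l `&` piece sch A j l' = set0.
Proof.
move=> rA jA lA lA' ll'.
have [_ /trivIsetP] := region_pieces sch_valid rA jA; exact.
Qed.

Lemma continuing_pairwise k w : pairwise (@disjointb T) (cont k w).
Proof.
elim: k => [//|k IH] /=; apply: pairwise_disjointb_flatten.
  exact: pairwise_filter.
move=> A; rewrite mem_filter => /andP[As Ac].
have rA := continuing_region Ac; have jA := way_lt_nways Ac As.
split; last first.
  move=> B /mapP[l]; rewrite mem_iota => /andP[_ lA] ->.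
  exact: piece_subset rA _ _.
set m := npieces sch A (way X k A w).
rewrite pairwise_map; apply: (@sub_in_pairwise _ (mem (iota 0 m)) ltn).
- move=> l l'; rewrite /= !mem_iota => /andP[_ lA] /andP[_ lA'] ll'.
  by apply/asboolP; apply: piece_disjoint rA jA lA lA' _; rewrite neq_ltn ll'.
- by apply/allP.
- by rewrite -sorted_pairwise ?iota_ltn_sorted//; exact: ltn_trans.
Qed.

Lemma continuing_disjoint k w A B : A \in cont k w -> B \in cont k w ->
  A != B -> A `&` B = set0.
Proof.
move=> Ac Bc AB; apply/asboolP; move: Ac Bc AB.
have := continuing_pairwise k w; elim: (cont k w) => //= C s IH /andP[/allP Cs ps].
rewrite !inE => /orP[/eqP->|As] /orP[/eqP->|Bs]; rewrite ?eqxx// => AB.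
- exact/asboolP/Cs.
- by rewrite setIC; apply/asboolP/Cs.
- exact/asboolP/IH.
Qed.

Lemma continuing_uniq k w : uniq (cont k w).
Proof.
have := continuing_pairwise k w.
have : forall A, A \in cont k w -> A <> set0.
  by move=> A /continuing_region; exact: region_neq0.
elim: (cont k w) => //= A s IH s0 /andP[/allP As ps]; rewrite IH//; last first.
  by move=> B Bs; apply: s0; rewrite inE Bs orbT.
rewrite andbT; apply/negP => /As /asboolP; rewrite setIid.
exact: s0 (mem_head _ _).
Qed.

Lemma stopped_partS k w : stopped k.+1 w =
  stopped k w `|` [set x | exists A, [/\ A \in cont k w, stop X k A w & A x]].
Proof.
rewrite /= -bigcup_seq_cond; congr (_ `|` _); apply/seteqP; split => x /=.
  by move=> [A /= /andP[Ac As] Ax]; exists A.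
by move=> [A [Ac As Ax]]; exists A => //=; rewrite Ac.
Qed.

Lemma stopped_continuing k w A : A \in cont k w -> stopped k w `&` A = set0.
Proof.
elim: k A => [|k IH B]; first by move=> A _; rewrite set0I.
move=> /continuingSP[A [Ac As] [l lA ->]]; apply/seteqP; split => // x.
have sA := piece_subset (continuing_region Ac) (way_lt_nways Ac As) lA.
move=> [+ /sA Ax]; rewrite stopped_partS => -[sx|[C [Cc Cs Cx]]].
  by rewrite -(IH _ Ac).
rewrite -(@continuing_disjoint k w C A)//.
by apply: contraNneq As => <-.
Qed.

Local Notation u := (uniform_on mu).

Lemma uniform_on_disjoint A B : A `&` B = set0 -> u A B = 0.
Proof. by rewrite /uniform_on => ->; rewrite measure0 mul0r. Qed.

Lemma uniform_on_self k A : region Om sch k A -> u A A = 1.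
Proof. by move=> /region_fine_gt0 A0; rewrite /uniform_on setIid divff// gt_eqF. Qed.

Lemma uniform_on_ge0 A B : 0 <= u A B.
Proof. by rewrite divr_ge0// fine_ge0. Qed.

Lemma uniform_on_le1 k A B : region Om sch k A -> measurable B -> u A B <= 1.
Proof.
move=> rA mB; rewrite ler_pdivrMr ?(region_fine_gt0 rA)// mul1r.
have mA := region_measurable sch_valid rA.
have le : (mu (A `&` B) <= mu A)%E.
  by apply: le_measure; rewrite ?inE//; exact: measurableI.
rewrite fine_le ?(region_fin_num rA)//.
by rewrite ge0_fin_numE// (le_lt_trans le)// ltey_eq (region_fin_num rA).
Qed.

Lemma random_measure_set0 k w : rm k w set0 = 0.
Proof.
elim: k => [|k IH]; first by rewrite /= uniform_on_disjoint// setI0.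
rewrite [LHS]/= setI0 IH add0r big1// => A _; rewrite big1// => l _.
by rewrite uniform_on_disjoint ?mulr0// setI0.
Qed.

(** The piece misses the stopped part, its siblings and the other continuing regions, so a single
    term of the defining formula survives. This is the recursion Q^(k+1)(A_l^j) = Q^(k)(A) theta_l^j
    of the model. *)
Lemma random_measure_piece k w A l :
  A \in cont k w -> ~~ stop X k A w ->
  forall lA : (l < npieces sch A (way X k A w))%N,
  rm k.+1 w (piece sch A (way X k A w) l) =
  rm k w A * tnth (share X k A (way X k A w) w) (Ordinal lA).
Proof.
move=> Ac As lA; have rA := continuing_region Ac; have jA := way_lt_nways Ac As.
have Bc : piece sch A (way X k A w) l \in cont k.+1 w.
  by apply/continuingSP; exists A => //; exists l.
rewrite [LHS]/= (_ : _ `&` _ = set0); last exact: stopped_continuing Bc.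
rewrite random_measure_set0 add0r -big_filter.
rewrite (bigD1_seq A) ?mem_filter ?As ?filter_uniq ?continuing_uniq//=.
rewrite (bigD1 (Ordinal lA))//= (uniform_on_self (piece_region rA jA lA)) mulr1.
rewrite big1 ?addr0 => [|l' ll']; last first.
  rewrite uniform_on_disjoint ?mulr0//.
  by apply: piece_disjoint rA jA _ _ _.
rewrite big_seq_cond big1 ?addr0// => C; rewrite mem_filter.
move=> /andP[/andP[Cs Cc] CA].
rewrite big1// => l' _; rewrite uniform_on_disjoint ?mulr0//.
have sC := piece_subset (continuing_region Cc) (way_lt_nways Cc Cs) (ltn_ord l').
have sA := piece_subset rA jA lA.
apply/seteqP; split => // x [/sC Cx /sA Ax].
by rewrite -(continuing_disjoint Cc Ac CA).
Qed.

Definition stopped_mass k w (B : set T) : R :=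
  \sum_(A <- cont k w | stop X k A w) rm k w A * u A B.

(** Partial sum of the limit series plus a remainder carried by T_1^k. The induction applies the
    hypothesis to B cut down to [stopped k.+1 w]: this leaves the terms of all regions stopped so
    far unchanged and annihilates those of the regions that go on, which the second summand of
    Q^(k+1) replaces by their pieces. *)
Lemma random_measureE k w B : rm k w B =
  \sum_(i < k) stopped_mass i w B + \sum_(A <- cont k w) rm k w A * u A B.
Proof.
elim: k B => [|k IH] B.
  rewrite big_ord0 add0r /= big_seq1 (@uniform_on_self 0) ?mul1r//.
have -> : rm k.+1 w B = rm k w (stopped k.+1 w `&` B) +
  \sum_(A <- cont k w | ~~ stop X k A w)
    \sum_(l < npieces sch A (way X k A w))
       rm k w A * tnth (share X k A (way X k A w) w) l *
       u (piece sch A (way X k A w) l) B by [].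
have uS i A : (i <= k)%N -> A \in cont i w -> stop X i A w ->
    u A (stopped k.+1 w `&` B) = u A B.
  move=> ik Ac As; rewrite /uniform_on setIA; congr (fine (mu (_ `&` _)) / _).
  apply/setIidPl; elim: k ik {IH} => [|k IHk].
    rewrite leqn0 => /eqP i0 x Ax; rewrite i0 in Ac As.
    by rewrite stopped_partS; right; exists A.
  rewrite leq_eqVlt => /orP[/eqP ik x Ax|/IHk Ak].
    by rewrite stopped_partS; right; exists A; rewrite -ik.
  by rewrite stopped_partS => x /Ak; left.
rewrite IH big_ord_recr/= -!addrA; congr (_ + _).
  apply: eq_bigr => i _; rewrite /stopped_mass big_seq_cond [RHS]big_seq_cond.
  by apply: eq_bigr => A /andP[Ac As]; rewrite (uS i)// ltnW.
rewrite (bigID (fun A => stop X k A w))/= -addrA; congr (_ + _).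
  rewrite /stopped_mass big_seq_cond [RHS]big_seq_cond.
  by apply: eq_bigr => A /andP[Ac As]; rewrite (uS k).
rewrite big_seq_cond big1 ?add0r => [|A /andP[Ac As]]; last first.
  rewrite uniform_on_disjoint ?mulr0// setIA.
  suff -> : A `&` stopped k.+1 w = set0 by rewrite set0I.
  apply/seteqP; split => // x [Ax]; rewrite stopped_partS => -[sx|[C [Cc Cs Cx]]].
    by rewrite -(stopped_continuing Ac).
  by rewrite -(@continuing_disjoint k w C A)//; apply: contraNneq As => <-.
rewrite [in RHS]big_flatten/= big_map big_filter.
rewrite big_seq_cond [RHS]big_seq_cond; apply: eq_bigr => A /andP[Ac As].
rewrite big_map -[in RHS](subn0 (npieces _ _ _)) -/(index_iota 0 _) big_mkord.
apply: eq_bigr => -[l lA] _; congr (_ * _); apply/esym.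
exact: random_measure_piece.
Qed.

(** * The limit measure along a path with all shares in the simplex *)

Definition in_simplex (n : nat) (t : n.-tuple R) : Prop :=
  (forall l, 0 <= tnth t l) /\ \sum_(l < n) tnth t l = 1.

Section good_path.
Variable w : W.
Hypothesis shares : forall k A, A \in cont k w -> ~~ stop X k A w ->
  in_simplex (share X k A (way X k A w) w).

(** The q_k of the overview. The absolute value changes nothing on a good path; it makes q_k
    nonnegative at every outcome, so that it can be integrated as a nonnegative function. *)
Definition continuing_mass k := \sum_(A <- cont k w) `|rm k w A|.

Lemma random_measure_ge0 k A : A \in cont k w -> 0 <= rm k w A.
Proof.
elim: k A => [A|k IH B].
  by rewrite inE => /eqP -> /=; rewrite (@uniform_on_self 0).
move=> /continuingSP[A [Ac As] [l lA ->]]; rewrite (random_measure_piece _ _ lA)//.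
have [share_ge0 _] := shares Ac As.
by rewrite mulr_ge0 ?IH.
Qed.

(** The shares sum to 1, so the pieces of a region carry together its mass. Hence the drop q_k -
    q_{k+1} is the mass stopped in step k + 1. *)
Lemma sum_continuingS k : continuing_mass k.+1 =
  \sum_(A <- cont k w | ~~ stop X k A w) `|rm k w A|.
Proof.
rewrite /continuing_mass [in LHS]big_flatten/= big_map big_filter.
rewrite big_seq_cond [RHS]big_seq_cond; apply: eq_bigr => A /andP[Ac As].
have [share_ge0 share1] := shares Ac As.
rewrite big_map -[in LHS](subn0 (npieces _ _ _)) -/(index_iota 0 _) big_mkord.
rewrite -[RHS]mulr1 -share1 mulr_sumr; apply: eq_bigr => -[l lA] _.
transitivity `|rm k w A * tnth (share X k A (way X k A w) w) (Ordinal lA)|.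
  by congr `| _ |; exact: random_measure_piece.
by rewrite normrM (ger0_norm (share_ge0 _)).
Qed.

Lemma continuing_mass0 : continuing_mass 0 = 1.
Proof.
by rewrite /continuing_mass big_seq1/= (@uniform_on_self 0)// normr1.
Qed.

Lemma stopped_mass_ge0 k B : 0 <= stopped_mass k w B.
Proof.
rewrite /stopped_mass big_seq_cond; apply: sumr_ge0 => A /andP[Ac _].
by rewrite mulr_ge0 ?uniform_on_ge0 ?random_measure_ge0.
Qed.

Lemma stopped_mass_le k B : measurable B ->
  stopped_mass k w B <= continuing_mass k - continuing_mass k.+1.
Proof.
move=> mB; rewrite sum_continuingS /continuing_mass.
rewrite (bigID (fun A => stop X k A w))/= addrK /stopped_mass.
rewrite big_seq_cond [leRHS]big_seq_cond; apply: ler_sum => A /andP[Ac _].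
rewrite ger0_norm ?random_measure_ge0//.
rewrite -[leRHS]mulr1 ler_wpM2l ?random_measure_ge0//.
exact: (uniform_on_le1 (continuing_region Ac)).
Qed.

Lemma stopped_mass_total k B : Om `<=` B ->
  stopped_mass k w B = continuing_mass k - continuing_mass k.+1.
Proof.
move=> OmB; rewrite sum_continuingS /continuing_mass.
rewrite (bigID (fun A => stop X k A w))/= addrK /stopped_mass.
rewrite big_seq_cond [RHS]big_seq_cond; apply: eq_bigr => A /andP[Ac _].
have rA := continuing_region Ac.
rewrite ger0_norm ?random_measure_ge0// /uniform_on.
rewrite (setIidl (subset_trans (region_subset rA) OmB)).
by rewrite divff ?mulr1// gt_eqF// (region_fine_gt0 rA).
Qed.

Lemma continuing_mass_ge0 k : 0 <= continuing_mass k.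
Proof. exact: sumr_ge0. Qed.

(** The drops telescope to q_m - q_n. The bound is uniform in n and B, which is what gives
    convergence in variational distance. *)
Lemma sum_stopped_mass_le m n B : (m <= n)%N -> measurable B ->
  \sum_(m <= i < n) stopped_mass i w B <= continuing_mass m.
Proof.
move=> mn mB.
apply: (@le_trans _ _
  (\sum_(m <= i < n) - (continuing_mass i.+1 - continuing_mass i))).
  by apply: ler_sum => i _; rewrite opprB stopped_mass_le.
by rewrite sumrN telescope_sumr// opprB lerBlDr lerDl continuing_mass_ge0.
Qed.

Let stopped_regions k := [seq A <- cont k w | stop X k A w].

(** [msum] takes a measure for every natural index, so the restriction must also make sense beyond
    the end of the list; there the default [Om] is returned, which is measurable. *)
Let measurable_nth k j : measurable (nth Om (stopped_regions k) j).
Proof.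
have [jk|jk] := ltnP j (size (stopped_regions k)); last first.
  by rewrite nth_default//; exact: (region_measurable sch_valid (k := 0)).
have := mem_nth Om jk; rewrite mem_filter => /andP[_ /continuing_region].
exact: (region_measurable sch_valid).
Qed.

Let region_weight_ge0 k A : 0 <= `|rm k w A| / fine (mu A).
Proof. by rewrite divr_ge0// fine_ge0. Qed.

(** [stopped_mass k w] assembled from scaled restrictions of [mu], so that countable additivity
    comes from the constructors. The absolute value makes the scaling factor nonnegative without any
    condition on the region. *)
Definition stopped_measure k : {measure set T -> \bar R} :=
  msum (fun j => mscale (NngNum (region_weight_ge0 k (nth Om (stopped_regions k) j)))
                   (mrestr mu (measurable_nth k j)))
       (size (stopped_regions k)).

Lemma stopped_measureE k B : measurable B ->
  stopped_measure k B = (stopped_mass k w B)%:E.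
Proof.
move=> mB; rewrite /stopped_measure/= /msum/= /stopped_mass -[in RHS]big_filter.
rewrite [in RHS](big_nth Om) big_mkord -sumEFin; apply: eq_bigr => -[j jk] _ /=.
rewrite /mscale/= /mrestr setIC.
set A := nth _ _ _.
have [As Ac] : stop X k A w /\ A \in cont k w.
  by have := mem_nth Om jk; rewrite mem_filter => /andP[].
have rA := continuing_region Ac.
rewrite ger0_norm ?random_measure_ge0//.
have fin : mu (A `&` B) \is a fin_num.
  rewrite ge0_fin_numE//; apply: (@le_lt_trans _ _ (mu A)).
    have mA := region_measurable sch_valid rA.
    by apply: le_measure; rewrite ?inE//; exact: measurableI.
  by rewrite ltey_eq (region_fin_num rA).
by rewrite -(fineK fin) -EFinM /uniform_on mulrAC mulrA.
Qed.

Definition limit_measure : {measure set T -> \bar R} :=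
  mseries stopped_measure 0.

Lemma limit_measureE B : measurable B ->
  limit_measure B = (\sum_(0 <= i <oo) (stopped_mass i w B)%:E)%E.
Proof.
by move=> mB; apply: eq_eseriesr => i _; exact: stopped_measureE.
Qed.

Lemma limit_measure_dominates : limit_measure `<< mu.
Proof.
apply/null_content_dominatesP => B mB B0; rewrite limit_measureE//.
apply: eseries0 => i _ _; rewrite /stopped_mass big_seq_cond big1// => A.
move=> /andP[/continuing_region/(region_measurable sch_valid) mA _].
rewrite /uniform_on (_ : mu _ = 0%E) ?mul0r ?mulr0//.
apply/eqP; rewrite eq_le measure_ge0 andbT -[leRHS]B0.
by apply: le_measure; rewrite ?inE//; exact: measurableI.
Qed.

(** Used twice: for [setT] it makes the limit a probability on T, for [Om] it says that this
    probability lives on Omega. *)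
Lemma limit_measure_total B : measurable B -> Om `<=` B ->
  continuing_mass @ \oo --> 0 -> limit_measure B = 1%E.
Proof.
move=> mB OmB q0; rewrite limit_measureE//; apply/cvg_lim => //.
rewrite (_ : (fun n => _) = EFin \o (fun n => 1 - continuing_mass n)).
  apply: cvg_EFin; first exact: nearW.
  by rewrite -[X in _ --> X]subr0; apply: cvgB => //; exact: cvg_cst.
apply/funext => n /=; rewrite sumEFin -continuing_mass0; congr EFin.
under eq_bigr do rewrite stopped_mass_total// -opprB.
by rewrite sumrN telescope_sumr// opprB.
Qed.

(** The first k terms of the series cancel. What is left is r - t, with r the part of Q^(k)(B) in
    T_1^k and t the tail of the series; both lie between 0 and q_k. *)
Lemma random_measure_limit_dist k B : measurable B ->
  (`|(rm k w B)%:E - limit_measure B| <= (continuing_mass k)%:E)%E.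
Proof.
move=> mB; rewrite limit_measureE// random_measureE.
have S0 n : xpredT n -> (0 <= (stopped_mass n w B)%:E)%E.
  by move=> _; rewrite lee_fin stopped_mass_ge0.
rewrite (nneseries_split 0 k); last by move=> n _; exact: S0.
rewrite add0n big_mkord sumEFin.
set s := \sum_(i < k) _; set r := \sum_(A <- _) _.
set t := (\sum_(k <= i <oo) _)%E.
have t0 : (0 <= t)%E by apply: nneseries_ge0 => n _ _; exact: S0.
have tq : (t <= (continuing_mass k)%:E)%E.
  apply: lime_le; first by apply: is_cvg_nneseries => n _ _; exact: S0.
  near=> n; rewrite sumEFin lee_fin sum_stopped_mass_le//.
  by near: n; exact: nbhs_infty_ge.
have tfin : t \is a fin_num by rewrite ge0_fin_numE// (le_lt_trans tq)// ltry.
rewrite -(fineK tfin) -[X in (_ - X)%E]EFinD -EFinB lee_fin.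
have r0 : 0 <= r.
  rewrite /r big_seq_cond; apply: sumr_ge0 => A /andP[Ac _].
  by rewrite mulr_ge0 ?uniform_on_ge0 ?random_measure_ge0.
have rq : r <= continuing_mass k.
  rewrite /r /continuing_mass big_seq_cond [leRHS]big_seq_cond.
  apply: ler_sum => A /andP[Ac _]; rewrite ger0_norm ?random_measure_ge0//.
  rewrite -[leRHS]mulr1 ler_wpM2l ?random_measure_ge0//.
  exact: (uniform_on_le1 (continuing_region Ac)).
rewrite opprD addrACA subrr add0r ler_norml.
have ft0 : 0 <= fine t by exact: fine_ge0.
have ftq : fine t <= continuing_mass k by rewrite -lee_fin fineK.
by apply/andP; split; lra.
Unshelve. all: by end_near. Qed.

Lemma random_measure_cvg : continuing_mass @ \oo --> 0 ->
  exists Q : probability T R, [/\ Q Om = 1%E, Q `<< mu &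
    (fun k => variational_distance Om (rm k w) Q) @ \oo --> 0%E].
Proof.
move=> q0.
have mOm : measurable Om by exact: (region_measurable sch_valid (k := 0)).
pose mix := Measure_isProbability.Build _ _ _ limit_measure
  (limit_measure_total measurableT (@subsetT _ Om) q0).
pose Q : probability T R :=
  HB.pack (limit_measure : set T -> \bar R) (Measure.on limit_measure) mix.
exists Q; split.
- exact: limit_measure_total.
- exact: limit_measure_dominates.
- apply: (@squeeze_cvge _ _ _ _ (cst 0%E) _ (fun k => (continuing_mass k)%:E)).
  + apply: nearW => k; apply/andP; split.
      apply: (@le_trans _ _ `|(rm k w set0)%:E - Q set0|%E); first exact: abse_ge0.
      by apply: ereal_sup_ubound; exists set0 => //; split => //; exact: sub0set.
    apply: ge_ereal_sup => _ [B [mB _] <-].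
    exact: random_measure_limit_dist.
  + exact: cvg_cst.
  + by apply: cvg_EFin; [exact: nearW|exact: q0].
Qed.

End good_path.

End path.

(** * The support and total mass of the Dirichlet distribution *)

Section dirichlet_facts.
Context {R : realType}.

Lemma dirichlet_ge0 K (a : nat -> R) (U : set (K.-tuple R)) :
  0 <= dirichlet a U.
Proof.
by rewrite divr_ge0// fine_ge0// integral_ge0// => t _;
  rewrite lee_fin prodr_ge0// => i _; exact: powR_ge0.
Qed.

(* Whether or not the normalizing integral is finite: the quotient x / x is 1
   or 0. *)
Lemma dirichletT_le1 K (a : nat -> R) : dirichlet a [set: K.-tuple R] <= 1.
Proof.
rewrite /dirichlet; set x := fine _.
by have [->|x0] := eqVneq x 0; rewrite ?mul0r// divff.
Qed.

Lemma sum_simplex_point K (t : K.-1.-tuple R) : (0 < K)%N ->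
  \sum_(i < K) tnth (simplex_point t) i = 1.
Proof.
case: K t => // K t _; under eq_bigr do rewrite tnth_mktuple.
(* The last index exceeds the length of [t], so [nth] returns its default, the complement to 1 of
   the other coordinates. *)
rewrite big_ord_recr/= nth_default ?size_tuple//.
rewrite (big_tuple _ _ t)/=.
under eq_bigr => i _ do rewrite (set_nth_default 0) ?size_tuple// -tnth_nth.
by rewrite addrC subrK.
Qed.

(** The density is integrated only over parameters whose [simplex_point] has positive coordinates;
    such a point lies in the simplex, so the domain of integration is empty and the numerator is
    0. *)
Lemma dirichlet_not_in_simplex K (a : nat -> R) : (0 < K)%N ->
  dirichlet a [set t : K.-tuple R | ~ in_simplex t] = 0.
Proof.
move=> K0; rewrite /dirichlet /dirichlet_mass [X in integral _ X](_ : _ = set0).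
  by rewrite integral_set0 mul0r.
apply/seteqP; split => // t [t0]; apply; split => [i|]; first exact/ltW/t0.
exact: sum_simplex_point.
Qed.

Lemma measurable_in_simplex n : measurable [set t : n.-tuple R | in_simplex t].
Proof.
rewrite (_ : [set t | _] =
  \big[setI/setT]_(i < n) ((fun t => tnth t i) @^-1` [set x | 0 <= x]) `&`
  ((fun t => \sum_(i < n) tnth t i) @^-1` [set 1])).
  apply: measurableI.
    apply: bigsetI_measurable => i _; rewrite -[X in measurable X]setTI.
    apply: measurable_tnth => //.
    by rewrite -set_itvcy; exact: measurable_itv.
  rewrite -[X in measurable X]setTI.
  by apply: measurable_sum => // i; exact: measurable_tnth.
apply/seteqP; split => t /= [h1 h2]; split => //.
  by rewrite -bigcap_seq => i _ /=; exact: h1.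
by move=> i; move: h1; rewrite -bigcap_seq => /(_ i); apply; rewrite /= mem_index_enum.
Qed.

End dirichlet_facts.

Lemma measure_bigsetU_le d (T : ringOfSetsType d) (R : realFieldType)
    (mu : {content set T -> \bar R}) (I : Type) (s : seq I) (F : I -> set T) :
  (forall i, measurable (F i)) ->
  (mu (\big[setU/set0]_(i <- s) F i) <= \sum_(i <- s) mu (F i))%E.
Proof.
move=> mF; elim: s => [|i s IH]; first by rewrite !big_nil measure0.
rewrite !big_cons; apply: le_trans (leeD (lexx _) IH).
have mU : measurable (\big[setU/set0]_(j <- s) F j) by exact: bigsetU_measurable.
have := @Boole_inequality _ _ _ mu (bigcup2 (F i) (\big[setU/set0]_(j <- s) F j)) 2.
rewrite !big_ord_recl !big_ord0 /= setU0 adde0; apply.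
by move=> [|[|n]] /=.
Qed.

(** * The filtration and the measurability of the decompositions *)

Section process.
Context {R : realType} {d : measure_display} {T : measurableType d}.
Variable Om : set T.
Variable sch : partition_scheme T.
Context {dW : measure_display} {W : measurableType dW}.
Variable X : draws R sch W.
Variables (lambda : set T -> nat -> R) (alpha : set T -> nat -> nat -> R).
Variables (P : probability W R) (rho : nat -> set T -> W -> R).
Hypothesis law : recursive_partitioning Om X P lambda alpha rho.

Local Notation cont := (continuing Om X).
Local Notation stopped := (stopped_part Om X).
Local Notation F k := (filtration Om X k).

Let way_lt_nways k A w : A \in cont k w -> ~~ stop X k A w ->
  (way X k A w < nways sch A)%N.
Proof. exact: (way_lt law). Qed.

Let contR := continuing_region way_lt_nways.

(** The carrier [W] with F^(k) as its sigma-algebra, which turns F^(k)-measurability into ordinary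
    measurability. *)
Definition FW k : measurableType _ := g_sigma_algebraType (drawn_events Om X k).

Lemma filtration_mono k : F k `<=` F k.+1.
Proof.
apply: sub_sigma_algebra2 => E [i [A [ik rA h]]]; exists i, A; split => //.
exact: ltnW.
Qed.

(** All that the next decomposition needs to know about A, with [None] for stopping. The values form
    a countable type, which makes histories codable. *)
Definition outcome k (A : set T) (w : W) : option nat :=
  if stop X k A w then None else Some (way X k A w).

Lemma filtration_outcome k A o : region Om sch k A ->
  F k.+1 [set w | A \in cont k w /\ outcome k A w = o].
Proof.
move=> rA; apply: sub_sigma_algebra; exists k, A; split => //.
case: o => [j|]; last first.
  left; apply/seteqP; split => w /= [Ac]; rewrite /outcome.
    by case: ifP.
  by move=> ->.
right; exists j, setT; split; first exact: measurableT.
apply/seteqP; split => w /=; rewrite /outcome.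
  by move=> [Ac]; case: ifP => // As [->].
by move=> [Ac /negbTE -> -> _].
Qed.

Lemma filtration_outcomes k (G : set W) D os : F k G ->
  (forall w, G w -> cont k w = D) ->
  F k.+1 (G `&` [set w | [seq outcome k A w | A <- D] = os]).
Proof.
move=> FG GD.
have [->|/set0P[w0 Gw0]] := eqVneq G set0.
  by rewrite set0I; exact: sigma_algebra0.
have rD A : A \in D -> region Om sch k A by rewrite -(GD _ Gw0); exact: contR.
(* Induction on a sublist D' of D, while G keeps fixing the whole decomposition D. *)
have {Gw0} : {subset D <= D} by [].
move: {1 3}D os => D'; elim: D' => [|A D' IH] [|o os] D'D.
- rewrite (_ : _ `&` _ = G); first exact: filtration_mono.
  by apply/seteqP; split => [w []|w].
- rewrite (_ : _ `&` _ = set0); first exact: sigma_algebra0.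
  by apply/seteqP; split => [w []|w].
- rewrite (_ : _ `&` _ = set0); first exact: sigma_algebra0.
  by apply/seteqP; split => [w []|w].
have AD : A \in D by exact/D'D/mem_head.
have D'D' : {subset D' <= D} by move=> B BD; apply: D'D; rewrite inE BD orbT.
have m1 := filtration_outcome o (rD _ AD).
have m2 := IH os D'D'.
have := @measurableI _ (FW k.+1) _ _ m1 m2; congr (F k.+1).
apply/seteqP; split => w /=.
  by move=> [[_ <-] [Gw <-]].
by move=> [Gw [<- <-]]; split => //; split => //; rewrite (GD _ Gw).
Qed.

(* The decomposition after k steps takes countably many values; the codes make
   it an F^(k)-measurable variable although set T is uncountable. *)
Lemma continuing_codable k : exists (code : W -> nat) (D : nat -> seq (set T))
    (S : nat -> set T),
  (forall n, F k [set w | code w = n]) /\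
  (forall w, cont k w = D (code w) /\ stopped k w = S (code w)).
Proof.
elim: k => [|k [code [D [S [Fcode codeE]]]]].
  exists (fun=> 0%N), (fun=> [:: Om]), (fun=> set0); split => // -[|n].
    rewrite (_ : [set w | _] = setT); last by apply/seteqP; split.
    exact: (@measurableT _ (FW 0)).
  rewrite (_ : [set w | _] = set0); last by apply/seteqP; split.
  exact: sigma_algebra0.
pose os w := [seq outcome k A w | A <- cont k w].
exists (fun w => pickle (code w, os w)).
exists (fun m =>
   if (unpickle m : option (nat * seq (option nat))) is Some (n, s) then
   flatten [seq (if x.2 is Some j then
                   [seq piece sch x.1 j l | l <- iota 0 (npieces sch x.1 j)]
                 else [::]) | x <- zip (D n) s] else [::]).
exists (fun m =>
   if (unpickle m : option (nat * seq (option nat))) is Some (n, s) then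
   S n `|` \big[setU/set0]_(x <- zip (D n) s | x.2 == None) x.1 else set0).
split => [m|w]; last first.
  rewrite pickleK; have [DE SE] := codeE w; rewrite -DE -SE.
  rewrite /os zip_map_r; split.
    rewrite /= -map_comp; elim: (cont k w) => //= A s IH.
    by rewrite -IH /outcome; case: (stop X k A w).
  rewrite /= big_map; congr (_ `|` _); apply: eq_bigl => A.
  by rewrite /outcome/=; case: ifP.
case E : (@unpickle (nat * seq (option nat))%type m) => [[n s]|]; last first.
  rewrite (_ : [set w | _] = set0); first exact: sigma_algebra0.
  apply/seteqP; split => // w /= wm.
  by move: E; rewrite -wm pickleK.
(* A number may decode to (n, s) without being its code; then it is not a value of the new code and
   its fibre is empty. *)
have [nsm|nsm] := eqVneq (pickle (n, s)) m; last first.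
  rewrite (_ : [set w | _] = set0); first exact: sigma_algebra0.
  apply/seteqP; split => // w /= wm.
  by move: E nsm; rewrite -wm pickleK => -[<- <-]; rewrite eqxx.
have := @filtration_outcomes k [set w | code w = n] (D n) s (Fcode n).
move=> /(_ (fun w wn => etrans (codeE w).1 (congr1 D wn))).
congr (F _); apply/seteqP; split => w /=.
  by move=> [wn ws]; rewrite -nsm -ws -wn /os (codeE w).1.
rewrite -nsm => /(pcan_inj pickleK)[<- <-]; split => //.
by rewrite /os (codeE w).1.
Qed.

(** Z is arbitrary: the event is a countable union of fibres of the code, each of which belongs to
    F^(k). *)
Lemma filtration_continuing k (Z : set (seq (set T) * set T)) :
  F k [set w | Z (cont k w, stopped k w)].
Proof.
have [code [D [S [Fcode codeE]]]] := continuing_codable k.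
rewrite (_ : [set w | _] =
   \bigcup_n ([set w | code w = n] `&` [set _ | Z (D n, S n)])).
  apply: (@bigcupT_measurable _ (FW k)) => n.
  apply: measurableI; first exact: Fcode.
  have [Zn|Zn] := pselect (Z (D n, S n)).
    by rewrite (_ : [set _ | _] = setT)//; apply/seteqP; split.
  by rewrite (_ : [set _ | _] = set0)//; apply/seteqP; split.
apply/seteqP; split => w /=.
  by have [-> ->] := codeE w; exists (code w).
by move=> [n _ [<- ]] /=; have [-> ->] := codeE w.
Qed.

(** Strong induction, because a generator of F^(k) mentions the event that A is continuing after i <
    k steps, and this event is measurable as a member of F^(i). *)
Lemma filtration_measurable k : F k `<=` measurable.
Proof.
elim/ltn_ind: k => k IH.
apply: smallest_sub; first exact: sigma_algebra_measurable.
move=> E [i [A [ik rA EE]]].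
have mc : measurable [set w | A \in cont i w].
  exact: (IH _ ik _ (@filtration_continuing i (fun p => A \in p.1))).
have ms : measurable [set w | stop X i A w].
  rewrite (_ : [set w | _] = stop X i A @^-1` [set true]); last first.
    by apply/seteqP; split.
  by rewrite -[X in measurable X]setTI; exact: measurable_funP.
case: EE => [->|[j [V [mV ->]]]]; first exact: (measurableI _ _ mc ms).
have mw : measurable [set w | way X i A w = j].
  rewrite (_ : [set w | _] = way X i A @^-1` [set j]); last first.
    by apply/seteqP; split.
  by rewrite -[X in measurable X]setTI; exact: measurable_funP.
have mv : measurable (share X i A j @^-1` V).
  by rewrite -[X in measurable X]setTI; exact: measurable_funP.
have := measurableI _ _ (measurableI _ _ mc (measurableC ms))
  (measurableI _ _ mw mv).
congr (measurable _); apply/seteqP; split => w /=.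
  by move=> [[? /negP ?] [? ?]]; split.
by move=> [? /negP ? ? ?].
Qed.

End process.

Lemma sum_option (V : nmodType) (I : finType) (f : option I -> V) :
  \sum_o f o = f None + \sum_i f (Some i).
Proof.
rewrite (bigD1 None)//=; congr (_ + _).
rewrite (reindex_omap Some id)/=; last by case.
by apply: eq_bigl => i; rewrite eqxx.
Qed.

(** * Marginals of the joint law of one step *)

Section law.
Context {R : realType} {d : measure_display} {T : measurableType d}.
Variables (mu : {measure set T -> \bar R}) (Om : set T).
Variable sch : partition_scheme T.
Context {dW : measure_display} {W : measurableType dW}.
Variable X : draws R sch W.
Variables (lambda : set T -> nat -> R) (alpha : set T -> nat -> nat -> R).
Variables (P : probability W R) (rho : nat -> set T -> W -> R).
Hypothesis sch_valid : valid_scheme mu Om sch.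
Hypothesis lambda_prob : selection_probabilities Om sch lambda.
Hypothesis law : recursive_partitioning Om X P lambda alpha rho.

Local Notation cont := (continuing Om X).
Local Notation F k := (filtration Om X k).

Let contR := continuing_region (way_lt law).

Lemma measurable_stop k A s : measurable [set w | stop X k A w = s].
Proof.
rewrite (_ : [set w | _] = stop X k A @^-1` [set s]); last first.
  by apply/seteqP; split.
by rewrite -[X in measurable X]setTI; exact: measurable_funP.
Qed.

Lemma measurable_way k A j : measurable [set w | way X k A w = j].
Proof.
rewrite (_ : [set w | _] = way X k A @^-1` [set j]); last first.
  by apply/seteqP; split.
by rewrite -[X in measurable X]setTI; exact: measurable_funP.
Qed.

Lemma measurable_share k A j (V : set ((npieces sch A j).-tuple R)) :
  measurable V -> measurable [set w | V (share X k A j w)].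
Proof.
by move=> mV; rewrite -[X in measurable X]setTI; exact: measurable_funP.
Qed.

Lemma measurable_rho k A (G : set W) : F k G -> region Om sch k A ->
  (forall w, G w -> A \in cont k w) -> measurable_fun G (rho k A).
Proof.
move=> FG rA GA mG V mV.
have mE := filtration_measurable law (rho_measurable law rA mV).
have := measurableI _ _ mG mE; congr (measurable _).
by apply/seteqP; split => w /= [Gw]; [case|split => //; split => //; exact: GA].
Qed.

(* draws_law is summed over the joint outcomes f of the draws of all regions of D
   that agree with (j0, V) at A0; None stands for stopping. Only an upper bound
   results, because the factors dirichlet setT are merely known to be <= 1. *)
Lemma prob_way_share_le k D (G : set W) A0 j0
    (V : forall A j, set ((npieces sch A j).-tuple R)) :
  F k G -> (forall w, G w -> cont k w = D) -> A0 \in D ->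
  (j0 < nways sch A0)%N -> (forall A j, measurable (V A j)) ->
  (P (G `&` [set w | [/\ ~~ stop X k A0 w, way X k A0 w = j0 &
                        V A0 j0 (share X k A0 j0 w)]]) <=
   \int[P]_(w in G) ((1 - rho k A0 w) * lambda A0 j0 *
                     dirichlet (alpha A0 j0) (V A0 j0))%:E)%E.
Proof.
move=> FG GD A0D j0A mV.
have mG := filtration_measurable law FG.
have [->|/set0P[w0 Gw0]] := eqVneq G set0.
  by rewrite set0I measure0 integral_set0.
have rD A : A \in D -> region Om sch k A by rewrite -(GD _ Gw0); exact: contR.
have uD : uniq D.
  by rewrite -(GD _ Gw0); exact: continuing_uniq sch_valid (way_lt law) _ _.
pose n := size D; pose A_ (i : 'I_n) := nth set0 D i.
(* A common bound on the numbers of ways, so that one finite type [option 'I_m] holds the outcomes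
   of all regions; labels that are not ways of the region get weight 0. *)
pose m := \max_(A <- D) nways sch A.
have A_D i : A_ i \in D by exact: mem_nth.
have i0P : (index A0 D < n)%N by rewrite index_mem.
pose i0 : 'I_n := Ordinal i0P.
have A_i0 : A_ i0 = A0 by exact: nth_index.
have A_index i : insub (index (A_ i) D) = Some i.
  by rewrite index_uniq//; exact: valK.
have A_eq i : (A_ i == A0) = (i == i0).
  by rewrite -A_i0 nth_uniq.
pose U A j := if A == A0 then V A j else setT.
have mU A j : measurable (U A j) by rewrite /U; case: ifP.
pose way_ok i (j : nat) := (j < nways sch (A_ i))%N && ((i == i0) ==> (j == j0)).
pose wt w i (o : option 'I_m) : R :=
  if o is Some j then
    if way_ok i j then (1 - rho k (A_ i) w) * lambda (A_ i) j *
       dirichlet (alpha (A_ i) j) (U (A_ i) j) else 0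
  else if i == i0 then 0 else rho k (A_ i) w.
pose good (f : {ffun 'I_n -> option 'I_m}) :=
  [forall i, if f i is Some j then way_ok i j else i != i0].
(* [draws_law] asks for a valid way at stopped regions as well; the default 0 is one, as every
   region has at least one way. *)
pose jf (f : {ffun 'I_n -> option 'I_m}) A : nat :=
  if insub (index A D) is Some i then if f i is Some j then j else 0%N else 0%N.
pose sf (f : {ffun 'I_n -> option 'I_m}) A : bool :=
  if insub (index A D) is Some i then f i == None else true.
have jfE f i : jf f (A_ i) = if f i is Some j then (j : nat) else 0%N.
  by rewrite /jf A_index.
have sfE f i : sf f (A_ i) = (f i == None) by rewrite /sf A_index.
have D_A A : A \in D -> exists i, A = A_ i.
  move=> AD; have iP : (index A D < n)%N by rewrite index_mem.
  by exists (Ordinal iP); rewrite /A_ nth_index.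
have rho01 i w : G w -> 0 <= rho k (A_ i) w <= 1.
  by move=> Gw; apply: (rho_itv law); rewrite (GD _ Gw).
have lam0 i j : (j < nways sch (A_ i))%N -> 0 <= lambda (A_ i) j.
  by have [+ _] := lambda_prob (rD _ (A_D i)); exact.
have wt0 w i o : G w -> 0 <= wt w i o.
  move=> Gw; have /andP[r0 r1] := rho01 i w Gw.
  case: o => [j|] /=; last by case: ifP.
  case: ifP => // /andP[ji _].
  by apply: mulr_ge0 (dirichlet_ge0 _ _); rewrite mulr_ge0 ?subr_ge0 ?lam0.
have mrho i : measurable_fun G (rho k (A_ i)).
  by apply: measurable_rho => //; [exact: rD|move=> w /GD ->].
have mwt i o : measurable_fun G (fun w => wt w i o).
  case: o => [j|] /=; last by case: (i == i0).
  case: (way_ok i j) => //; apply: measurable_funM => //.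
  by apply: measurable_funM => //; exact: measurable_funB.
pose E f : set W := if good f then
  G `&` [set w | forall A, A \in D -> stop X k A w = sf f A /\
     (~~ sf f A -> way X k A w = jf f A /\ U A (jf f A) (share X k A (jf f A) w))]
  else set0.
have mE f : measurable (E f).
  rewrite /E; case: ifP => // _; apply: measurableI => //.
  rewrite (_ : [set w | _] = \big[setI/setT]_(A <- D)
    ([set w | stop X k A w = sf f A] `&` (if sf f A then setT else
      [set w | way X k A w = jf f A] `&`
      [set w | U A (jf f A) (share X k A (jf f A) w)]))).
    apply: bigsetI_measurable => A _; apply: measurableI.
      exact: measurable_stop.
    case: ifP => // _; apply: measurableI; first exact: measurable_way.
    by apply: measurable_share.
  rewrite -bigcap_seq; apply/seteqP; split => w /= h A AD.
    by have [h1 h2] := h A AD; split => //; case: ifP => // sA; apply: h2; rewrite sA.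
  by have [h1 h2] := h A AD; split => //; case: ifP h2.
have PE f : (P (E f) <= \int[P]_(w in G) (\prod_i wt w i (f i))%:E)%E.
  rewrite /E; case: ifPn => [gf|_]; last first.
    rewrite measure0; apply: integral_ge0 => w Gw.
    by rewrite lee_fin prodr_ge0// => i _; exact: wt0.
  move/forallP : gf => gf.
  have jU A : A \in D -> (jf f A < nways sch A)%N /\ measurable (U A (jf f A)).
    move=> /[dup] AD /D_A[i ->]; split => //; rewrite jfE.
    have := gf i; case: (f i) => [j /andP[]//|_].
    exact: (nways_gt0 sch_valid (rD _ (A_D i))).
  rewrite (draws_law law FG GD (sf f) (U := fun A => U A (jf f A)) jU).
  rewrite le_eqVlt; apply/orP; left; apply/eqP.
  apply: eq_integral => w /set_mem Gw; congr EFin.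
  rewrite (big_nth set0) big_mkord; apply: eq_bigr => i _.
  rewrite -/(A_ i) sfE /wt.
  have := gf i; have := jfE f i.
  case: (f i) => [j|] /=; last by move=> _ /negbTE ->.
  by move=> -> ->.
have cover : G `&` [set w | [/\ ~~ stop X k A0 w, way X k A0 w = j0 &
    V A0 j0 (share X k A0 j0 w)]] `<=`
    \big[setU/set0]_(f <- index_enum {ffun 'I_n -> option 'I_m}) E f.
  move=> w [Gw [s0 w0j v0]]; rewrite -bigcup_seq.
  have wm i : ~~ stop X k (A_ i) w ->
      (way X k (A_ i) w < nways sch (A_ i))%N /\ (way X k (A_ i) w < m)%N.
    move=> si; have wi : (way X k (A_ i) w < nways sch (A_ i))%N.
      by apply: (way_lt law) si; rewrite (GD _ Gw).
    split => //; apply: (leq_trans wi); exact: leq_bigmax_seq.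
  pose f : {ffun 'I_n -> option 'I_m} :=
    [ffun i => if stop X k (A_ i) w then None else insub (way X k (A_ i) w)].
  have fi i : if stop X k (A_ i) w then f i = None else
      exists2 j, f i = Some j & nat_of_ord j = way X k (A_ i) w.
    rewrite ffunE; have := wm i; case: (stop X k (A_ i) w) => // /(_ isT)[_ wim].
    by exists (Ordinal wim) => //; rewrite insubT.
  exists f; first exact: mem_index_enum.
  rewrite /E ifT; last first.
    apply/forallP => i; have := fi i; case: ifPn => [si ->|si [j -> jE]].
      by apply: contraTneq si => ->; rewrite A_i0.
    rewrite /way_ok jE (wm _ si).1/=; apply/implyP => /eqP ->.
    by rewrite A_i0 w0j.
  split => // A /D_A[i ->]; rewrite sfE jfE.
  have := fi i; case: ifPn => [si ->//|si [j -> jE]]; split => // _.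
  rewrite jE; split => //; rewrite /U; case: ifP => // /eqP Ai.
  by rewrite Ai w0j.
apply: (@le_trans _ _
  (P (\big[setU/set0]_(f <- index_enum {ffun 'I_n -> option 'I_m}) E f))).
  apply: le_measure => //; rewrite inE.
    apply: measurableI => //.
    rewrite (_ : [set w | _] = [set w | stop X k A0 w = false] `&`
      ([set w | way X k A0 w = j0] `&` [set w | V A0 j0 (share X k A0 j0 w)])).
      apply: measurableI; first exact: measurable_stop.
      by apply: measurableI; [exact: measurable_way|exact: measurable_share].
    apply/seteqP; split => w /=.
      by move=> [/negbTE ? ? ?].
    by move=> [-> [? ?]].
  exact: bigsetU_measurable.
apply: (le_trans (measure_bigsetU_le _ _ mE)).
apply: (le_trans (lee_sum _ (fun f _ => PE f))).
have mprod (f : {ffun 'I_n -> option 'I_m}) :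
    measurable_fun G (fun w => (\prod_i wt w i (f i))%:E).
  by apply/measurable_EFinP; apply: measurable_prod => i _; exact: mwt.
rewrite -ge0_integral_sum//; last first.
  move=> f w Gw; rewrite lee_fin prodr_ge0// => i _; exact: wt0.
apply: ge0_le_integral => //.
- move=> w Gw; apply: sume_ge0 => f _; rewrite lee_fin prodr_ge0// => i _.
  exact: wt0.
- exact: emeasurable_sum.
- apply/measurable_EFinP; apply: measurable_funM => //.
  apply: measurable_funM => //; apply: measurable_funB => //.
  by rewrite -A_i0; exact: mrho.
(* The sum over joint outcomes of products becomes a product over regions of sums. The factor at
   [i0] is the wanted integrand; any other factor is at most rho + (1 - rho) \sum_j lambda_j = 1. *)
move=> w Gw; rewrite sumEFin -(bigA_distr_bigA (wt w)) lee_fin.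
rewrite (bigD1 i0)//=.
have -> : \sum_o wt w i0 o = (1 - rho k A0 w) * lambda A0 j0 *
                     dirichlet (alpha A0 j0) (V A0 j0).
  rewrite sum_option/= eqxx add0r.
  have j0m : (j0 < m)%N.
    by apply: (leq_trans j0A); exact: leq_bigmax_seq.
  rewrite (bigD1 (Ordinal j0m))//= big1 => [|j jj0]; last first.
    rewrite /way_ok eqxx/= ifF//; apply/negbTE; rewrite negb_and.
    by apply/orP; right; exact: jj0.
  by rewrite addr0 /way_ok A_i0 j0A !eqxx/= /U eqxx.
apply: ler_piMr.
  apply: mulr_ge0 (dirichlet_ge0 _ _); apply: mulr_ge0.
    by have := rho01 i0 w Gw; rewrite A_i0 subr_ge0 => /andP[].
  by have := lam0 i0 j0; rewrite A_i0; apply.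
apply: prodr_ile1 => i ii0; rewrite sumr_ge0 => [/=|o _]; last exact: wt0.
have /andP[r0 r1] := rho01 i w Gw.
rewrite sum_option/= (negbTE ii0).
rewrite -[leRHS](subrKC (rho k (A_ i) w)) lerD2l.
have [lam_ge0 lam1] := lambda_prob (rD _ (A_D i)).
rewrite -[leRHS]mulr1 -[X in _ <= _ * X]lam1.
have nwm : (nways sch (A_ i) <= m)%N by exact: leq_bigmax_seq.
rewrite (big_ord_widen _ (lambda (A_ i)) nwm) mulr_sumr [leRHS]big_mkcond/=.
apply: ler_sum => j _; rewrite /way_ok (negbTE ii0) andbT.
case: ifP => // ji.
rewrite -[leRHS]mulr1 ler_wpM2l//.
  by rewrite mulr_ge0 ?subr_ge0 ?lam_ge0.
by rewrite /U A_eq (negbTE ii0) dirichletT_le1.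
Qed.

End law.

(** Moves the domain of integration into the measure, so that integrals over different sets can be
    compared through their measures. *)
Lemma ge0_integral_mrestr d (T : measurableType d) (R : realType)
    (m : {measure set T -> \bar R}) (D : set T) (mD : measurable D)
    (f : T -> \bar R) :
  measurable_fun setT f -> (forall x, 0 <= f x)%E ->
  (\int[mrestr m mD]_x f x = \int[m]_(x in D) f x)%E.
Proof.
move=> mf f0; have mCD := measurableC mD.
rewrite -(setvU D) ge0_integral_setU//; last 2 first.
  by rewrite setvU.
  by apply/disj_setPS => x [].
rewrite [X in (X + _)%E](_ : _ = 0%E) ?add0e.
  apply: eq_measure_integral => A mA AD.
  by rewrite /mrestr; congr (m _); apply/setIidPl.
rewrite (eq_measure_integral (mzero : {measure set T -> \bar R})).
  exact: integral_measure_zero.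
move=> A mA AD; rewrite /= /mrestr (_ : A `&` D = set0) ?measure0//.
by apply/seteqP; split => // x [/AD].
Qed.

(** * Stopping probabilities and almost sure simplex shares *)

Section decay.
Context {R : realType} {d : measure_display} {T : measurableType d}.
Variables (mu : {measure set T -> \bar R}) (Om : set T).
Variable sch : partition_scheme T.
Context {dW : measure_display} {W : measurableType dW}.
Variable X : draws R sch W.
Variables (lambda : set T -> nat -> R) (alpha : set T -> nat -> nat -> R).
Variables (P : probability W R) (rho : nat -> set T -> W -> R) (delta : R).
Hypothesis sch_valid : valid_scheme mu Om sch.
Hypothesis mu_Om : (mu Om < +oo)%E.
Hypothesis lambda_prob : selection_probabilities Om sch lambda.
Hypothesis law : recursive_partitioning Om X P lambda alpha rho.
Hypothesis delta_le1 : delta <= 1.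
Hypothesis rho_gt : {ae P, forall w, forall k A, A \in continuing Om X k w ->
  delta < rho k A w}.

Local Notation cont := (continuing Om X).
Local Notation rm := (random_measure mu Om X).
Local Notation F k := (filtration Om X k).

Let contR := continuing_region (way_lt law).

(** The integrated form of P(S = 0 | F^(k)) <= 1 - delta: the bound for a single way, with the share
    left free, is summed over the ways, and the selection probabilities add up to 1. *)
Lemma prob_not_stop_le k D (G : set W) A :
  F k G -> (forall w, G w -> cont k w = D) -> A \in D ->
  (P (G `&` [set w | ~~ stop X k A w]) <= (1 - delta)%:E * P G)%E.
Proof.
move=> FG GD AD; have mG := filtration_measurable law FG.
have [->|/set0P[w0 Gw0]] := eqVneq G set0.
  by rewrite set0I measure0 mule0.
have GA w : G w -> A \in cont k w by move=> /GD ->.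
have rA : region Om sch k A by exact: contR (GA _ Gw0).
have [lam_ge0 lam1] := lambda_prob rA.
pose E (j : 'I_(nways sch A)) := G `&` [set w | [/\ ~~ stop X k A w,
  way X k A w = j & [set: (npieces sch A j).-tuple R] (share X k A j w)]].
have mE j : measurable (E j).
  apply: measurableI => //.
  rewrite (_ : [set w | _] = [set w | stop X k A w = false] `&`
      [set w | way X k A w = j]).
    by apply: measurableI; [exact: measurable_stop|exact: measurable_way].
  apply/seteqP; split => w /=; first by move=> [/negbTE].
  by move=> [-> ?].
have mrho : measurable_fun G (rho k A) by exact: measurable_rho law _ _ _ FG rA GA.
have rho01 w : G w -> 0 <= rho k A w <= 1 by move=> /GA; exact: (rho_itv law).
pose h (j : 'I_(nways sch A)) w : \bar R := ((1 - rho k A w) * lambda A j *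
  dirichlet (alpha A j) [set: (npieces sch A j).-tuple R])%:E.
have h0 j w : G w -> (0 <= h j w)%E.
  move=> /rho01/andP[r0 r1]; rewrite lee_fin; apply: mulr_ge0 (dirichlet_ge0 _ _).
  by rewrite mulr_ge0 ?subr_ge0 ?lam_ge0.
have mh j : measurable_fun G (h j).
  apply/measurable_EFinP; apply: measurable_funM => //.
  by apply: measurable_funM => //; exact: measurable_funB.
apply: (@le_trans _ _ (P (\big[setU/set0]_(j < nways sch A) E j))).
  apply: le_measure; rewrite ?inE.
  - apply: measurableI => //.
    rewrite (_ : [set w | _] = [set w | stop X k A w = false]).
      exact: measurable_stop.
    by apply/seteqP; split => w /= => [/negbTE|->].
  - exact: bigsetU_measurable.
  - move=> w [Gw /= sw]; rewrite -bigcup_seq.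
    exists (Ordinal (way_lt law (GA _ Gw) sw)); first exact: mem_index_enum.
    by split.
apply: (le_trans (measure_bigsetU_le _ _ mE)).
apply: (@le_trans _ _ (\sum_(j < nways sch A) \int[P]_(w in G) h j w)%E).
  apply: lee_sum => j _.
  exact: (prob_way_share_le sch_valid lambda_prob law (V := fun A j => setT)
    FG GD AD (ltn_ord j)).
rewrite -ge0_integral_sum// -integral_cst//.
apply: ae_ge0_le_integral => //.
- by move=> w Gw; apply: sume_ge0 => j _; exact: h0.
- exact: emeasurable_sum.
- by move=> w _; rewrite lee_fin subr_ge0.
apply: filterS rho_gt => w rho_gtw Gw; rewrite sumEFin lee_fin.
have /andP[r0 r1] := rho01 w Gw; have := rho_gtw k A (GA _ Gw) => r_gt.
apply: (@le_trans _ _ (1 - rho k A w)); last by rewrite lerD2l lerN2 ltW.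
rewrite -[leRHS]mulr1 -[X in _ <= _ * X]lam1 mulr_sumr; apply: ler_sum => j _.
rewrite -[leRHS]mulr1 ler_wpM2l ?dirichletT_le1//.
by rewrite mulr_ge0 ?subr_ge0 ?lam_ge0.
Qed.

(** The regions are indexed by a code and a position in the decoded list. This leaves countably many
    events, and each is null because the Dirichlet distribution gives the complement of the simplex
    probability 0. *)
Lemma share_in_simplex_ae : {ae P, forall w, forall k A, A \in cont k w ->
  ~~ stop X k A w -> in_simplex (share X k A (way X k A w) w)}.
Proof.
have npieces_gt0 k A j : region Om sch k A -> (j < nways sch A)%N ->
    (0 < npieces sch A j)%N.
  move=> rA jA; rewrite lt0n; apply/eqP => n0.
  have [] := region_pieces sch_valid rA jA; rewrite n0 => AE _.
  by apply: (region_neq0 sch_valid rA); rewrite AE II0 bigcup_set0.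
apply: ae_foralln => k.
have [code [D [S [Fcode codeE]]]] := continuing_codable law k.
suff : {ae P, forall w, forall n i j, code w = n -> (i < size (D n))%N ->
    ~~ stop X k (nth set0 (D n) i) w ->
    way X k (nth set0 (D n) i) w = j ->
    in_simplex (share X k (nth set0 (D n) i) j w)}.
  apply: filterS => w H A Ac As.
  have Ac' : A \in D (code w) by rewrite -(codeE w).1.
  have iA : (index A (D (code w)) < size (D (code w)))%N by rewrite index_mem.
  have := H (code w) (index A (D (code w))) (way X k A w) erefl iA.
  by rewrite nth_index//; exact.
apply: ae_foralln => n; apply: ae_foralln => i; apply: ae_foralln => j.
have [iD|iD] := ltnP i (size (D n)); last first.
  by apply: nearW => w _.
set A := nth _ _ _.
have AD : A \in D n by exact: mem_nth.
have GD w : [set w | code w = n] w -> cont k w = D n.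
  by move=> /= <-; exact: (codeE w).1.
have [[w0 [w0n w0j]]|noG] := pselect (exists w, code w = n /\ (j < nways sch A)%N);
    last first.
  apply: nearW => w wn _ As wj; exfalso; apply: noG; exists w; split => //.
  by rewrite -wj; apply: (way_lt law) As; rewrite GD.
have rA : region Om sch k A by apply: (@contR _ w0); rewrite GD.
have mV B l : measurable [set t : (npieces sch B l).-tuple R | ~ in_simplex t].
  exact: (measurableC (@measurable_in_simplex R (npieces sch B l))).
have := prob_way_share_le sch_valid lambda_prob law (Fcode n) GD AD w0j mV.
rewrite dirichlet_not_in_simplex; last exact: npieces_gt0 rA w0j.
under eq_integral do rewrite mulr0.
rewrite integral0.
set B := _ `&` _ => B0.
exists B; split.
- apply: measurableI; first exact: (filtration_measurable law (Fcode n)).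
  rewrite (_ : [set w | _] = [set w | stop X k A w = false] `&`
      ([set w | way X k A w = j] `&` [set w | ~ in_simplex (share X k A j w)])).
    apply: measurableI; first exact: measurable_stop.
    apply: measurableI; first exact: measurable_way.
    apply: (@measurable_share _ _ _ _ _ _ X k A j (~` [set t | in_simplex t])).
    exact: (measurableC (@measurable_in_simplex R (npieces sch A j))).
  apply/seteqP; split => w /=; first by move=> [/negbTE].
  by move=> [-> [? ?]].
- by apply/eqP; rewrite eq_le B0 measure_ge0.
- move=> w /= H; split.
    by apply: contrapT => wn; apply: H => /wn.
  split.
  - by apply/negP => sw; apply: H => _ _; rewrite sw.
  - by apply: contrapT => wj; apply: H => _ _ _ /wj.
  - by move=> sok; apply: H.
Qed.

End decay.

(** Meant for [phi] the identity from [W] to [FW k]: the hypothesis then concerns events of F^(k)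
    only, and the pushforwards are the restrictions of the two measures to F^(k). *)
Lemma ge0_le_integral_comp d1 d2 (X : measurableType d1) (Y : measurableType d2)
    (R : realType) (phi : X -> Y) (m1 m2 : {measure set X -> \bar R})
    (c : {nonneg R}) (f : Y -> \bar R) :
  measurable_fun setT phi -> measurable_fun setT f -> (forall y, 0 <= f y)%E ->
  (forall B, measurable B ->
     m1 (phi @^-1` B) <= c%:num%:E * m2 (phi @^-1` B))%E ->
  (\int[m1]_x f (phi x) <= c%:num%:E * \int[m2]_x f (phi x))%E.
Proof.
move=> mphi mf f0 m12.
have fE (m : {measure set X -> \bar R}) :=
  ge0_integral_pushforward mphi m measurableT mf (fun y _ => f0 y).
rewrite preimage_setT in fE; rewrite -!fE -ge0_integral_mscale//.
exact: ge0_le_measure_integral.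
Qed.

(** * Expected decay and almost sure vanishing of the continuing mass *)

Section integrals.
Context {R : realType} {d : measure_display} {T : measurableType d}.
Variables (mu : {measure set T -> \bar R}) (Om : set T).
Variable sch : partition_scheme T.
Context {dW : measure_display} {W : measurableType dW}.
Variable X : draws R sch W.
Variables (lambda : set T -> nat -> R) (alpha : set T -> nat -> nat -> R).
Variables (P : probability W R) (rho : nat -> set T -> W -> R) (delta : R).
Hypothesis sch_valid : valid_scheme mu Om sch.
Hypothesis mu_Om : (mu Om < +oo)%E.
Hypothesis lambda_prob : selection_probabilities Om sch lambda.
Hypothesis law : recursive_partitioning Om X P lambda alpha rho.
Hypothesis delta_le1 : delta <= 1.
Hypothesis rho_gt : {ae P, forall w, forall k A, A \in continuing Om X k w ->
  delta < rho k A w}.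

Local Notation cont := (continuing Om X).
Local Notation rm := (random_measure mu Om X).
Local Notation F k := (filtration Om X k).
Local Notation FW k := (FW Om X k).
Local Notation q := (continuing_mass mu Om X).

Let contR := continuing_region (way_lt law).

Lemma measurable_fun_FWS k d' (V : measurableType d') (f : W -> V) :
  @measurable_fun _ _ (FW k) V setT f -> @measurable_fun _ _ (FW k.+1) V setT f.
Proof. by move=> mf _ B mB; apply: filtration_mono; exact: mf. Qed.

Lemma measurable_fun_FW k d' (V : measurableType d') (f : W -> V) :
  @measurable_fun _ _ (FW k) V setT f -> measurable_fun [set: W] f.
Proof. by move=> mf _ B mB; apply: (filtration_measurable law); exact: mf. Qed.

(** Where the code and the outcomes of step k + 1 are fixed, the random index sets in Q^(k+1)(B)
    become constant lists, and a finite sum of measurable terms remains; countably many such events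
    cover W. *)
Lemma measurable_random_measure k B :
  @measurable_fun _ _ (FW k) R setT (fun w => rm k w B).
Proof.
elim: k B => [|k IH] B; first exact: measurable_cst.
have [code [D [S [Fcode codeE]]]] := continuing_codable law k.
pose C (x : nat * seq (option nat)) : set W := [set w | code w = x.1] `&`
  [set w | [seq outcome X k A w | A <- D x.1] = x.2].
have FC x : @measurable _ (FW k.+1) (C x).
  apply: (filtration_outcomes law _ (Fcode x.1)) => w /= <-.
  exact: (codeE w).1.
pose Cn m : set W :=
  if (unpickle m : option (nat * seq (option nat))) is Some x then C x else set0.
have -> : [set: FW k.+1] = \bigcup_m Cn m.
  apply/seteqP; split => // w _.
  exists (pickle (code w, [seq outcome X k A w | A <- D (code w)])) => //.
  by rewrite /Cn pickleK.
apply/measurable_fun_bigcup; rewrite /Cn.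
  by move=> m; case: unpickle => // x; exact: FC.
move=> m; case: unpickle => [[n os]|]; last exact: measurable_fun_set0.
have [->|/set0P[w0 Cw0]] := eqVneq (C (n, os)) set0.
  exact: measurable_fun_set0.
have CE w : C (n, os) w -> [/\ cont k w = D n, stopped_part Om X k w = S n &
    zip (D n) os = [seq (A, outcome X k A w) | A <- cont k w]].
  move=> [/= <- <-]; rewrite zip_map_r.
  by have [-> ->] := codeE w.
(* The membership test holds for every summand. It records in each term that A was really cut in the
   way j, so that its share is one of the variables generating F^(k+1). *)
pose g w : R := rm k w
    ((S n `|` \big[setU/set0]_(x <- zip (D n) os | x.2 == None) x.1) `&` B) +
  \sum_(x <- zip (D n) os) if x \in zip (D n) os then
    (if x.2 is Some j then \sum_(l < npieces sch x.1 j)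
       rm k w x.1 * tnth (share X k x.1 j w) l *
       uniform_on mu (piece sch x.1 j l) B
     else 0) else 0.
apply: (@eq_measurable_fun _ _ (FW k.+1) R _ g).
  move=> w /set_mem /CE [contE stopE zipE].
  rewrite /g [RHS]/= -stopE zipE big_map; congr (rm _ _ (_ `&` _) + _).
    rewrite /=; congr (_ `|` _); apply: eq_bigl => A.
    by rewrite /outcome/=; case: ifP.
  rewrite -big_mkcond -big_seq big_map [RHS]big_mkcond/=; apply: eq_bigr => A _.
  by rewrite /outcome; case: ifP.
have IH' B' : @measurable_fun _ _ (FW k.+1) R (C (n, os)) (fun w => rm k w B').
  apply: (@measurable_funS _ _ (FW k.+1) R setT) => //.
  exact: (measurable_fun_FWS (IH B')).
apply: measurable_funD; first exact: IH'.
apply: measurable_sum => -[A o]; case Ao : ((A, o) \in zip (D n) os) => //=.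
case: o Ao => // j Aj; apply: measurable_sum => l.
apply: measurable_funM => //; apply: measurable_funM; first exact: IH'.
apply: (@measurableT_comp _ _ _ _ _ _
  (fun t : (npieces sch A j).-tuple R => tnth t l)).
  exact: measurable_tnth.
have AjE w : C (n, os) w -> [/\ A \in cont k w, ~~ stop X k A w & way X k A w = j].
  move=> /CE[_ _ zipE]; move: Aj; rewrite zipE => /mapP[A' A'c [-> ]].
  by rewrite /outcome; case: ifP => // /negbT ? [].
have rA : region Om sch k A by have [/contR] := AjE _ Cw0.
move=> _ V mV.
have mE : F k.+1 [set w | [/\ A \in cont k w, ~~ stop X k A w, way X k A w = j &
    V (share X k A j w)]].
  apply: sub_sigma_algebra; exists k, A; split => //; right.
  by exists j, V.
have := @measurableI _ (FW k.+1) _ _ (FC (n, os)) mE; congr (F k.+1).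
apply/seteqP; split => w [Cw /=]; first by move=> [].
by have [? ? ?] := AjE _ Cw.
Qed.

Lemma measurable_sum_continuing k (h : set T -> W -> R) :
  (forall A, measurable_fun setT (h A)) ->
  measurable_fun setT (fun w => \sum_(A <- cont k w) h A w).
Proof.
move=> mh.
have [code [D [S [Fcode codeE]]]] := continuing_codable law k.
have -> : [set: W] = \bigcup_n [set w | code w = n].
  by apply/seteqP; split => // w _; exists (code w).
have mcode n : measurable [set w | code w = n].
  exact: (filtration_measurable law (Fcode n)).
apply/measurable_fun_bigcup => // n.
apply: (@eq_measurable_fun _ _ _ _ _ (fun w => \sum_(A <- D n) h A w)).
  by move=> w /set_mem/= <-; rewrite (codeE w).1.
apply: measurable_sum => A; exact: measurable_funS (mh A).
Qed.

(** On a fibre of the code the random list is constant and the sum leaves the integral; the bounds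
    for single regions are then added over the list and over the countably many fibres. *)
Lemma integral_sum_continuing_le k (h h' : set T -> W -> R) (c : R) :
  0 <= c ->
  (forall A, measurable_fun setT (h A)) -> (forall A w, 0 <= h A w) ->
  (forall A, measurable_fun setT (h' A)) -> (forall A w, 0 <= h' A w) ->
  (forall D (G : set W) A, F k G -> (forall w, G w -> cont k w = D) -> A \in D ->
    (\int[P]_(w in G) (h A w)%:E <= c%:E * \int[P]_(w in G) (h' A w)%:E)%E) ->
  (\int[P]_w (\sum_(A <- cont k w) h A w)%:E <=
   c%:E * \int[P]_w (\sum_(A <- cont k w) h' A w)%:E)%E.
Proof.
move=> c0 mh h0 mh' h'0 H.
have [code [D [S [Fcode codeE]]]] := continuing_codable law k.
have -> : [set: W] = \bigcup_n [set w | code w = n].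
  by apply/seteqP; split => // w _; exists (code w).
have mcode n : measurable [set w | code w = n].
  exact: (filtration_measurable law (Fcode n)).
have tcode : trivIset setT (fun n => [set w | code w = n]).
  apply/trivIsetP => i j _ _ ij; apply/seteqP; split => // w /= [wi wj].
  by move: ij; rewrite -wi -wj eqxx.
have mU : measurable (\bigcup_n [set w | code w = n]) by exact: bigcup_measurable.
rewrite !ge0_integral_bigcup//; last 4 first.
- apply: (@measurable_funS _ _ _ _ setT) => //.
  exact/measurable_EFinP/measurable_sum_continuing.
- by move=> w _; rewrite lee_fin sumr_ge0.
- apply: (@measurable_funS _ _ _ _ setT) => //.
  exact/measurable_EFinP/measurable_sum_continuing.
- by move=> w _; rewrite lee_fin sumr_ge0.
rewrite -nneseriesZl; last first.
  by move=> n _; apply: integral_ge0 => w _; rewrite lee_fin sumr_ge0.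
apply: lee_nneseries => [n _ _|n _].
  by apply: integral_ge0 => w _; rewrite lee_fin sumr_ge0.
have splitE (f : set T -> W -> R) : (forall A, measurable_fun setT (f A)) ->
    (forall A w, 0 <= f A w) ->
    (\int[P]_(w in [set w | code w = n]) (\sum_(A <- cont k w) f A w)%:E =
     \sum_(A <- D n) \int[P]_(w in [set w | code w = n]) (f A w)%:E)%E.
  move=> mf f0; rewrite -ge0_integral_sum//; last first.
  - by move=> A w _; rewrite lee_fin.
  - by move=> A; apply/measurable_EFinP; exact: measurable_funS (mf A).
  apply: eq_integral => w /set_mem/= wn.
  by rewrite (codeE w).1 wn sumEFin.
rewrite !splitE// ge0_sume_distrr; last first.
  by move=> A _; apply: integral_ge0 => w _; rewrite lee_fin.
rewrite big_seq [leRHS]big_seq; apply: lee_sum => A AD.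
by apply: (H (D n)) => // w /= <-; exact: (codeE w).1.
Qed.

(** For B in F^(k), [prob_not_stop_le] at the intersection of B and G compares P restricted to G and
    S = 0 with (1 - delta) times P restricted to G, as measures on F^(k); the integrals of the
    F^(k)-measurable f compare accordingly. *)
Lemma integral_not_stop_le k D (G : set W) A (f : W -> R) :
  @measurable_fun _ _ (FW k) R setT f -> (forall w, 0 <= f w) ->
  F k G -> (forall w, G w -> cont k w = D) -> A \in D ->
  (\int[P]_(w in G) (if stop X k A w then 0 else f w)%:E <=
   (1 - delta)%:E * \int[P]_(w in G) (f w)%:E)%E.
Proof.
move=> mf f0 FG GD AD.
have mG := filtration_measurable law FG.
have mS : measurable [set w | ~~ stop X k A w].
  rewrite (_ : [set w | _] = [set w | stop X k A w = false]).
    exact: measurable_stop.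
  by apply/seteqP; split => w /= => [/negbTE|->].
have mGS := measurableI _ _ mG mS.
have mfW := measurable_fun_FW mf.
rewrite (eq_integral ((EFin \o f) \_ [set w | ~~ stop X k A w])); last first.
  move=> w _; rewrite patchE; case: ifPn => sw.
    by rewrite memNset//= sw.
  by rewrite mem_set.
rewrite -integral_mkcondr.
have mid : @measurable_fun _ _ W (FW k) setT id.
  by move=> _ B FB; rewrite setTI; exact: (filtration_measurable law FB).
have d0 : 0 <= 1 - delta by rewrite subr_ge0.
have mfE : measurable_fun [set: W] (EFin \o f) by exact/measurable_EFinP.
have f0E x : (0 <= (EFin \o f) x)%E by rewrite lee_fin.
rewrite -(ge0_integral_mrestr P mGS)// -(ge0_integral_mrestr P mG)//.
apply: (@ge0_le_integral_comp _ _ W (FW k) R id _ _ (NngNum d0) (EFin \o f)) => //.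
  exact/measurable_EFinP.
move=> B FB; rewrite /= /mrestr preimage_id.
have FBG := @measurableI _ (FW k) _ _ FB FG.
have := @prob_not_stop_le _ _ _ _ _ _ _ _ _ _ _ _ _ _ sch_valid lambda_prob law
  delta_le1 rho_gt k D (B `&` G) A FBG.
rewrite setIA; apply => //.
by move=> w [_ /GD].
Qed.

Lemma measurable_norm_random_measure k A :
  @measurable_fun _ _ (FW k) R setT (fun w => `|rm k w A|).
Proof.
apply: (@measurableT_comp _ _ _ (FW k) _ _ (@Num.norm R R)) => //.
exact: measurable_random_measure.
Qed.

Lemma measurable_continuing_mass k : measurable_fun setT (fun w => q w k).
Proof.
rewrite /continuing_mass.
apply: (@measurable_sum_continuing k (fun A w => `|rm k w A|)) => A.
exact: (measurable_fun_FW (@measurable_norm_random_measure k A)).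
Qed.

(** Almost everywhere q_{k+1} equals the sum of [N], from which the shares of step k + 1 have
    disappeared: the only fresh variable left in each term is the stopping draw. *)
Lemma integral_continuing_massS_le k :
  (\int[P]_w (q w k.+1)%:E <= (1 - delta)%:E * \int[P]_w (q w k)%:E)%E.
Proof.
have mrm A := measurable_fun_FW (@measurable_norm_random_measure k A).
pose N A w := if stop X k A w then 0 else `|rm k w A|.
have mN A : measurable_fun setT (N A).
  exact: measurable_fun_ifT.
apply: (@le_trans _ _ (\int[P]_w (\sum_(A <- cont k w) N A w)%:E)%E); last first.
  apply: integral_sum_continuing_le => //.
  - by rewrite subr_ge0.
  - by move=> A w; rewrite /N; case: ifP.
  - move=> D G A FG GD AD.
    apply: (integral_not_stop_le _ _ FG GD AD) => //.
    exact: measurable_norm_random_measure.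
apply: ae_ge0_le_integral => //.
- by move=> w _; rewrite lee_fin sumr_ge0.
- exact/measurable_EFinP/measurable_continuing_mass.
- by move=> w _; rewrite lee_fin sumr_ge0// => A _; rewrite /N; case: ifP.
- exact/measurable_EFinP/measurable_sum_continuing.
apply: filterS (share_in_simplex_ae sch_valid lambda_prob law) => w shares _.
rewrite lee_fin (sum_continuingS sch_valid mu_Om (way_lt law) shares).
rewrite big_mkcond/=; apply: ler_sum => A _.
by rewrite /N; case: (stop X k A w).
Qed.

Lemma integral_continuing_mass_le k :
  (\int[P]_w (q w k)%:E <= ((1 - delta) ^+ k)%:E)%E.
Proof.
elim: k => [|k IH].
  rewrite (eq_integral (cst 1%E)) => [|w _].
    by rewrite integral_cst// mul1e; exact: probability_le1.
  by rewrite (continuing_mass0 X sch_valid mu_Om).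
apply: (le_trans (integral_continuing_massS_le k)).
by rewrite exprS EFinM lee_wpmul2l// lee_fin subr_ge0.
Qed.

(** By monotonicity q_k fails to vanish only if, for some n, all q_k are at least 1/(n+1). Markov's
    inequality bounds the probability of this event by (n+1) (1 - delta)^k for every k, hence by
    0. *)
Lemma continuing_mass_cvg_ae : 0 < delta ->
  {ae P, forall w, q w @ \oo --> 0}.
Proof.
move=> delta0.
have small : {ae P, forall w, forall n, ~ forall k, n.+1%:R^-1 <= q w k}.
  apply: ae_foralln => n; pose B := [set w | forall k, n.+1%:R^-1 <= q w k].
  have mB : measurable B.
    rewrite (_ : B = \bigcap_k [set w | n.+1%:R^-1 <= q w k]).
      apply: bigcap_measurable => // k _; rewrite -[X in measurable X]setTI.
      have := measurable_continuing_mass k.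
      move=> /(_ measurableT `[n.+1%:R^-1, +oo[%classic) /=.
      by rewrite preimage_itvcy; apply; exact: measurable_itv.
    by apply/seteqP; split => w /= h k => [_|]; exact: h.
  have mq k : measurable_fun setT (fun w => (q w k)%:E).
    exact/measurable_EFinP/measurable_continuing_mass.
  have q0 k w : (0 <= (q w k)%:E)%E by rewrite lee_fin sumr_ge0.
  have Bfin : P B \is a fin_num by exact: fin_num_measure.
  have PB k : n.+1%:R^-1 * fine (P B) <= (1 - delta) ^+ k.
    rewrite -lee_fin EFinM fineK//; apply: le_trans (integral_continuing_mass_le k).
    apply: (@le_trans _ _ (\int[P]_(w in B) (q w k)%:E)%E); last first.
      exact: ge0_subset_integral.
    rewrite -integral_cst//; apply: ge0_le_integral => //.
    - by move=> w _; rewrite lee_fin.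
    - exact: measurable_funS (mq k).
    - by move=> w Bw; rewrite lee_fin; exact: Bw.
  have PB0 : P B = 0%E.
    apply/eqP; rewrite eq_le measure_ge0 andbT -(fineK Bfin) lee_fin.
    rewrite -(@ler_pM2l _ n.+1%:R^-1) ?invr_gt0// mulr0.
    have d1 : `|1 - delta| < 1 by rewrite ger0_norm ?subr_ge0// gtrBl.
    have <- := cvg_lim (@Rhausdorff R) (cvg_expr d1).
    by apply: limr_ge; [apply/cvg_ex; exists 0; exact: cvg_expr|exact: nearW].
  by exists B; split => // w /= /contrapT.
apply: filterS2 small (share_in_simplex_ae sch_valid lambda_prob law).
move=> w small shares.
have qS k : q w k.+1 <= q w k.
  rewrite (sum_continuingS sch_valid mu_Om (way_lt law) shares).
  rewrite [leRHS](bigID (fun A => stop X k A w))/= lerDr.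
  by rewrite sumr_ge0.
have qmono : nonincreasing_seq (q w) by exact/nonincreasing_seqP.
apply/cvgrPdist_lt => e e0.
have [n ne] : exists n, n.+1%:R^-1 < e.
  have [n _ /(_ n)] := near_infty_natSinv_lt (PosNum e0).
  by rewrite /= leqnn => /(_ isT); exists n.
have [k /negP qk] : exists k, ~ n.+1%:R^-1 <= q w k.
  by apply/existsNP; exact: small.
near=> m; rewrite sub0r normrN ger0_norm; last exact: continuing_mass_ge0.
apply: (@le_lt_trans _ _ (q w k)); last first.
  by apply: lt_trans ne; rewrite ltNge.
by apply: qmono; near: m; exact: nbhs_infty_ge.
Unshelve. all: by end_near. Qed.

End integrals.

(** Finiteness of mu(Omega) is what gives the quotients in [uniform_on] their meaning, since [fine]
    sends +oo to 0. *)
Lemma base_space_fin (R : realType) d (T : measurableType d)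
    (mu : {measure set T -> \bar R}) (Om : set T) (reg : nat -> set (set T)) :
  base_space mu Om reg -> (mu Om < +oo)%E.
Proof.
case=> {d T mu Om reg} [d T reg fT _ _|p a b sa sb reg _ ab _].
  by rewrite /= /counting asboolT// ltry.
pose side i : set R := [set` Interval (BSide (sa i) (a i)) (BSide (sb i) (b i))].
rewrite [X in (X < _)%E](@lebesgue_tuple_box R p side) => [|i]; last first.
  exact: measurable_itv.
rewrite (eq_bigr (fun i => (b i - a i)%:E)) => [|i _].
  by rewrite prodEFin ltry.
by rewrite lebesgue_measure_itv/= lte_fin ab EFinN -EFinB.
Qed.

Theorem theorem1 (R : realType)
    (d : measure_display) (T : measurableType d)
    (mu : {measure set T -> \bar R}) (Om : set T)
    (sch : partition_scheme T)
    (lambda : set T -> nat -> R) (alpha : set T -> nat -> nat -> R)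
    (dW : measure_display) (W : measurableType dW) (P : probability W R)
    (X : draws R sch W) (rho : nat -> set T -> W -> R) (delta : R) :
  base_space mu Om (region Om sch) ->
  valid_scheme mu Om sch ->
  selection_probabilities Om sch lambda ->
  assignment_weights Om sch alpha ->
  recursive_partitioning Om X P lambda alpha rho ->
  0 < delta ->
  {ae P, forall w, forall k A, A \in continuing Om X k w ->
     delta < rho k A w < 1 - delta} ->
  {ae P, forall w, exists Q : probability T R,
     [/\ Q Om = 1%E,
         Q `<< mu &
         (fun k => variational_distance Om (random_measure mu Om X k w) Q)
           @ \oo --> 0%E]}.
Proof.
move=> /base_space_fin mu_Om sch_valid lambda_prob _ law delta0 rho_bounds.
have rho_gt : {ae P, forall w, forall k A, A \in continuing Om X k w ->
    delta < rho k A w}.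
  by apply: filterS rho_bounds => w H k A /H/andP[].
(* An event of full probability has a point. There [Om] is the continuing region of step 0, and 0 <=
   rho < 1 - delta bounds delta. *)
have delta_le1 : delta <= 1.
  have PT : (0 < P [set: W])%E by rewrite probability_setT lte01.
  have [w H] := @filter_ex _ _ (ae_properfilter_algebraOfSetsType PT) _ rho_bounds.
  have /andP[] := H 0%N Om (mem_head _ _).
  have /andP[r0 _] := rho_itv law (k := 0) (A := Om) (w := w) (mem_head _ _).
  by lra.
have := continuing_mass_cvg_ae sch_valid mu_Om lambda_prob law delta_le1 rho_gt
  delta0.
apply: filterS2 (share_in_simplex_ae sch_valid lambda_prob law) => w shares q0.
exact: (random_measure_cvg sch_valid mu_Om (way_lt law) shares q0).
Qed.
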